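(* Let $\Gamma$ be a countable discrete group and $(X,\mu)$ a standard probability space. For any nonempty convex set $K\subseteq\mathrm{A}_\sim(\Gamma,X,\mu)$ the function $d(\cdot,K)=\inf_{b\in K}d(\cdot,b)$ on $\mathrm{A}_\sim(\Gamma,X,\mu)$ is convex, i.e. $d(tx+(1-t)y,K)\le t\,d(x,K)+(1-t)\,d(y,K)$ for all $x,y\in\mathrm{A}_\sim(\Gamma,X,\mu)$ and $t\in[0,1]$.
   Context: A probability space is a standard Borel space with a Borel probability measure (atoms allowed); it is a standard probability space if the measure is nonatomic. A measure-preserving action of $\Gamma$ on $(Y,\nu)$ is a Borel action preserving $\nu$, two actions being identified if they agree almost everywhere; $\gamma^a$ denotes the transformation given by $\gamma\in\Gamma$ under the action $a$. $\mathrm{A}(\Gamma,X,\mu)$ is the set of measure-preserving actions of $\Gamma$ on $(X,\mu)$. Weak containment: for actions $a$ on $(X,\mu)$ and $b$ on $(Y,\nu)$, $a\prec b$ if for all measurable $A_1,\dots,A_n\subseteq X$, finite $F\subseteq\Gamma$ and $\epsilon>0$ there are measurable $B_1,\dots,B_n\subseteq Y$ with $|\mu(\gamma^aA_i\cap A_j)-\nu(\gamma^bB_i\cap B_j)|<\epsilon$ for all $\gamma\in F$, $i,j\le n$. $a\sim b$ means $a\prec b$ and $b\prec a$, and $\mathrm{A}_\sim(\Gamma,X,\mu)=\mathrm{A}(\Gamma,X,\mu)/\!\sim$. Metric: fix an enumeration $(\gamma_i)_{i\ge1}$ of $\Gamma$ (with repetitions if $\Gamma$ is finite). For $a\in \mathrm{A}(\Gamma,X,\mu)$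 and a measurable partition $\mathcal A=\{A_1,\dots,A_k\}$ of $X$ into $k$ pieces let $M^{\mathcal A}_{n,k}(a)\in[0,1]^{n\times k\times k}$ have $(p,q,r)$ coordinate $\mu(\gamma_p^aA_q\cap A_r)$, let $C_{n,k}(a)$ be the closure of the set of all $M^{\mathcal A}_{n,k}(a)$ over such $\mathcal A$, and let $d(a,b)=\sum_{n,k=1}^\infty 2^{-(n+k)}d_H(C_{n,k}(a),C_{n,k}(b))$, where $d_H$ is the Hausdorff distance (from the supremum metric on $[0,1]^{n\times k\times k}$). Then $d(a,b)=0$ iff $a\sim b$, so $d$ induces a metric on $\mathrm{A}_\sim(\Gamma,X,\mu)$, also denoted $d$. Convex structure: for $a,b\in\mathrm{A}(\Gamma,X,\mu)$ and $t\in[0,1]$, $t[a]+(1-t)[b]$ is the weak equivalence class of the action on $X_1\sqcup X_2$ (two copies of $X$, with measure $t\mu$ on $X_1$ and $(1-t)\mu$ on $X_2$) acting as $a$ on $X_1$ and $b$ on $X_2$, transported to $(X,\mu)$ by any isomorphism of probability spaces; this is well defined. A subset $K$ is convex if $tx+(1-t)y\in K$ for all $x,y\in K$, $t\in[0,1]$. *)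

(* Defs.v *)
From HB Require Import structures.
From mathcomp Require Import all_boot all_order all_algebra.
From mathcomp Require Import all_classical all_reals all_analysis.

Set Implicit Arguments.
Unset Strict Implicit.
Unset Printing Implicit Defensive.

Import Order.TTheory GRing.Theory Num.Theory.
Import numFieldNormedType.Exports.

Local Open Scope classical_set_scope.
Local Open Scope quotient_scope.
Local Open Scope ring_scope.

(* The sigma-algebra is that of the Borel sets of some Polish topology; a
   Hausdorff pseudometric space is a metric space. *)
Definition standard_borel (R : realType) d (X : measurableType d) : Prop :=
  exists (P : completePseudoMetricType R) (f : X -> P),
    [/\ hausdorff_space P,
        exists2 D : set P, countable D & dense D,
        bijective f &
        forall A : set X, measurable A <-> <<s [set U : set P | open U] >> (f @` A)].

Definition nonatomic (R : realType) d (X : measurableType d)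
    (mu : probability X R) : Prop :=
  forall A : set X, measurable A -> (0 < mu A)%E ->
    exists B : set X,
      [/\ measurable B, B `<=` A, (0 < mu B)%E & (mu B < mu A)%E].

Definition standard_probability (R : realType) d (X : measurableType d)
    (mu : probability X R) : Prop :=
  standard_borel R X /\ nonatomic mu.

(* As Gamma is discrete, a Borel action is one by Borel maps. Actions that agree
   almost everywhere are not identified here, but they are weakly equivalent,
   hence equal in the quotient [wclass] below. *)
Record mp_action (G : groupType) (R : realType) d (Y : measurableType d)
    (nu : {measure set Y -> \bar R}) := MpAction {
  act :> G -> Y -> Y;
  act1 : forall y, act 1%g y = y;
  actM : forall g h y, act (g * h)%g y = act g (act h y);
  measurable_act : forall g, measurable_fun setT (act g);
  act_preserving : forall g (A : set Y),
    measurable A -> nu (act g @^-1` A) = nu A }.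

HB.instance Definition _ (G : groupType) (R : realType) d (Y : measurableType d)
  (nu : {measure set Y -> \bar R}) := gen_eqMixin (mp_action G nu).
HB.instance Definition _ (G : groupType) (R : realType) d (Y : measurableType d)
  (nu : {measure set Y -> \bar R}) := gen_choiceMixin (mp_action G nu).

Definition weakly_contained (G : groupType) (R : realType)
    d (X : measurableType d) (mu : probability X R)
    d' (Y : measurableType d') (nu : probability Y R)
    (a : mp_action G mu) (b : mp_action G nu) : Prop :=
  forall (n : nat) (A : 'I_n -> set X) (F : set G) (eps : R),
    (forall i, measurable (A i)) -> finite_set F -> 0 < eps ->
    exists B : 'I_n -> set Y,
      (forall i, measurable (B i)) /\
      forall g i j, F g ->
        `| fine (mu ((a g @` A i) `&` A j))
           - fine (nu ((b g @` B i) `&` B j)) | < eps.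

Section weak_equivalence.
Variables (G : groupType) (R : realType) (d : measure_display).
Variables (X : measurableType d) (mu : probability X R).

Definition weakly_equivalent (a b : mp_action G mu) : bool :=
  `[< weakly_contained a b /\ weakly_contained b a >].

Lemma weakly_contained_refl (a : mp_action G mu) : weakly_contained a a.
Proof.
by move=> n A F eps mA _ e0; exists A; split => // g i j _; rewrite subrr normr0.
Qed.

Lemma weakly_contained_trans (a b c : mp_action G mu) :
  weakly_contained a b -> weakly_contained b c -> weakly_contained a c.
Proof.
move=> ab bc n A F eps mA fF e0.
have e20 : 0 < eps / 2 by rewrite divr_gt0.
have [B [mB AB]] := ab n A F _ mA fF e20.
have [C [mC BC]] := bc n B F _ mB fF e20.
exists C; split=> // g i j Fg.
rewrite (le_lt_trans (ler_distD (fine (mu ((b g @` B i) `&` B j))) _ _))//.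
by rewrite (splitr eps) ltrD ?AB ?BC.
Qed.

Lemma weakly_equivalent_refl : reflexive weakly_equivalent.
Proof. by move=> a; apply/asboolP; split; exact: weakly_contained_refl. Qed.

Lemma weakly_equivalent_sym : symmetric weakly_equivalent.
Proof.
by move=> a b; apply/asboolP/asboolP => -[]; split.
Qed.

Lemma weakly_equivalent_trans : transitive weakly_equivalent.
Proof.
move=> b a c /asboolP[ab ba] /asboolP[bc cb]; apply/asboolP.
by split; [exact: weakly_contained_trans bc|exact: weakly_contained_trans ba].
Qed.

Canonical weakly_equivalent_equiv := EquivRel weakly_equivalent
  weakly_equivalent_refl weakly_equivalent_sym weakly_equivalent_trans.

Definition wclass := {eq_quot weakly_equivalent}.

HB.instance Definition _ := Choice.on wclass.
HB.instance Definition _ := Quotient.on wclass.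

End weak_equivalence.

(* [wclass G mu] is the space of weak equivalence classes of actions of G on
   (X, mu). *)
Arguments wclass G {R d X} mu.

Definition measurable_partition d (X : measurableType d) (k : nat)
    (A : 'I_k -> set X) : Prop :=
  [/\ forall i, measurable (A i), trivIset setT A & \bigcup_i A i = setT].

Definition hausdorff_dist (R : realType) (T : pseudoMetricType R)
    (A B : set T) : \bar R :=
  maxe (ereal_sup [set edist_inf B x | x in A])
       (ereal_sup [set edist_inf A y | y in B]).

Section distance.
Variables (G : groupType) (R : realType) (d : measure_display).
Variables (X : measurableType d) (mu : probability X R).
(* [gam p] is the group element usually written gamma_(p+1). *)
Variable gam : nat -> G.

(* The n x k x k array is a row of n square matrices, so that the balls of its
   pseudometric are those of the supremum metric. *)
Definition correlations (n k : nat) (a : mp_action G mu) (A : 'I_k -> set X) :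
    'rV['M[R]_k]_n :=
  \row_p \matrix_(q, r) fine (mu ((a (gam p) @` A q) `&` A r)).

Definition correlation_set (n k : nat) (a : mp_action G mu) :
    set 'rV['M[R]_k]_n :=
  closure [set correlations n a A | A in @measurable_partition d X k].

Arguments correlation_set : clear implicits.

(* The entries of [correlations] are in [0, 1], so that this is finite. *)
Definition action_dist (a b : mp_action G mu) : \bar R :=
  (\sum_(1 <= n <oo) \sum_(1 <= k <oo)
     (2 ^- (n + k))%:E *
     hausdorff_dist (correlation_set n k a) (correlation_set n k b))%E.

Definition wdist (x y : wclass G mu) : \bar R := action_dist (repr x) (repr y).

Definition wdist_set (K : set (wclass G mu)) (x : wclass G mu) : \bar R :=
  ereal_inf [set wdist x b | b in K].

End distance.

(* Isomorphism of probability spaces modulo null sets. *)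
Definition prob_iso (R : realType) d (Y : measurableType d)
    d' (X : measurableType d') (nu : {measure set Y -> \bar R})
    (mu : {measure set X -> \bar R}) (phi : Y -> X) : Prop :=
  [/\ measurable_fun setT phi,
      forall A : set X, measurable A -> nu (phi @^-1` A) = mu A &
      exists psi : X -> Y,
        [/\ measurable_fun setT psi,
            forall B : set Y, measurable B -> mu (psi @^-1` B) = nu B,
            {ae nu, forall y, psi (phi y) = y} &
            {ae mu, forall x, phi (psi x) = x}]].

Definition transported (G : groupType) (R : realType) d (Y : measurableType d)
    d' (X : measurableType d') (nu : {measure set Y -> \bar R})
    (mu : {measure set X -> \bar R}) (phi : Y -> X)
    (s : mp_action G nu) (c : mp_action G mu) : Prop :=
  forall g, {ae nu, forall y, phi (s g y) = c g (phi y)}.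

Section convex_structure.
Variables (G : groupType) (R : realType) (d : measure_display).
Variables (X : measurableType d) (mu : probability X R).

(* The disjoint union of two copies of X is bool * X. For t in [0, 1] the
   measure below is t * mu on {true} * X and (1 - t) * mu on {false} * X. *)
Definition two_copies (t : R) : {measure set (bool * X) -> \bar R} :=
  (bernoulli_prob t \x mu)%E.

Lemma two_copiesE (t : R) (A : set (bool * X)) : 0 <= t <= 1 -> measurable A ->
  two_copies t A = (t%:E * mu [set x | A (true, x)] +
                    (1 - t)%:E * mu [set x | A (false, x)])%E.
Proof.
move=> t01 mA; rewrite /two_copies /= /product_measure1/=.
rewrite integral_bernoulli_prob//=.
by congr (_ * mu _ + _ * mu _)%E; apply/seteqP; split=> x;
  rewrite /xsection/= inE.
Qed.

Definition sum_act (a b : mp_action G mu) (g : G) (z : bool * X) : bool * X :=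
  (z.1, if z.1 then a g z.2 else b g z.2).

Lemma sum_act1 a b z : sum_act a b 1%g z = z.
Proof. by case: z => -[] x; rewrite /sum_act/= act1. Qed.

Lemma sum_actM a b g h z :
  sum_act a b (g * h)%g z = sum_act a b g (sum_act a b h z).
Proof. by case: z => -[] x; rewrite /sum_act/= actM. Qed.

Lemma measurable_sum_act a b g : measurable_fun setT (sum_act a b g).
Proof.
apply/measurable_fun_pair => //=; apply: measurable_fun_ifT => //=.
- exact: measurableT_comp (measurable_act a g) _.
- exact: measurableT_comp (measurable_act b g) _.
Qed.

Lemma sum_act_preserving t a b g (A : set (bool * X)) : measurable A ->
  two_copies t (sum_act a b g @^-1` A) = two_copies t A.
Proof.
move=> mA; apply: eq_integral => z _ /=.
have mAz : measurable (xsection A z) by exact: measurable_xsection.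
rewrite -(act_preserving (if z then a else b) g mAz); congr (mu _).
by apply/seteqP; split=> x; rewrite /xsection/= !inE /sum_act/=; case: z {mAz}.
Qed.

Definition sum_action (t : R) (a b : mp_action G mu) :
    mp_action G (two_copies t) :=
  MpAction (sum_act1 a b) (@sum_actM a b) (measurable_sum_act a b)
    (@sum_act_preserving t a b).

Definition is_convex_comb (t : R) (x y z : wclass G mu) : Prop :=
  exists (a b c : mp_action G mu) (phi : bool * X -> X),
    [/\ \pi_(wclass G mu) a = x, \pi_(wclass G mu) b = y,
        \pi_(wclass G mu) c = z, prob_iso (two_copies t) mu phi &
        transported phi (sum_action t a b) c].

(* t x + (1 - t) y, the unique z such that [is_convex_comb t x y z]: when
   (X, mu) is a standard probability space such a z exists and is unique, so
   that the default value of [xget] is not used. *)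
Definition convex_comb (t : R) (x y : wclass G mu) : wclass G mu :=
  xget x [set z | is_convex_comb t x y z].

Definition wconvex (K : set (wclass G mu)) : Prop :=
  forall (x y : wclass G mu) (t : R), K x -> K y -> 0 <= t <= 1 ->
    K (convex_comb t x y).

End convex_structure.

(* Main.v *)
Require Import Defs.
From mathcomp Require Import all_boot all_order all_algebra.
From mathcomp Require Import all_classical all_reals all_analysis.
From mathcomp Require Import measurable_realfun ring lra.

Set Implicit Arguments.
Unset Strict Implicit.
Unset Printing Implicit Defensive.

Import Order.TTheory GRing.Theory Num.Theory.
Import numFieldNormedType.Exports.
Local Open Scope classical_set_scope.
Local Open Scope ring_scope.

(** Why distance to a convex set is convex.

    Say that an action [b] simulates an action [a] up to [e] if the
    correlations of every finite partition are matched, up to [e], by those of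
    some partition for [b]. The Hausdorff distance of two correlation sets is
    the infimum of the [e] up to which the two actions simulate each other
    ([hausdorff_simulates], [simulates_hausdorff]). A partition of two
    copies of [X] is a pair of partitions of [X], and its correlations are the
    convex combination of the correlations of the two halves; so simulations of
    [a] by [a'] and of [b] by [b'] glue to a simulation of [t a + (1 - t) b] by
    [t a' + (1 - t) b'], with error [t e + (1 - t) f] ([simulates_convex]).
    Weakly equivalent actions simulate each other up to every positive error
    ([weakly_contained_simulates]), so representatives do not matter, and the
    distance is jointly convex: [hausdorff_convex] for each summand,
    [wdist_convex] for the sum. If [K] is convex and [b], [b'] are in [K], then
    [t b + (1 - t) b'] is in [K] and its distance to [t x + (1 - t) y] is at
    most [t d(x, b) + (1 - t) d(y, b')]; taking infima over [b] and [b']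
    independently gives the theorem.

    All this needs that convex combinations exist ([convex_combP]): two copies
    of [X], weighted [t] and [1 - t], must be isomorphic to [X] modulo null
    sets. A standard Borel space [X] carries measurable maps [h : X -> R] and
    [s : R -> X] with [s] a left inverse of [h] ([standard_borel_coding]); [h]
    records in ternary digits which basic open sets contain a point. If the
    measure has no atoms, the distribution function of [h] sends it to the
    uniform law on [[0, 1]], and the quantile function is an almost everywhere
    inverse ([atomless_uniform]). Hence any two atomless spaces that have such
    codings, in particular [X] and its two copies, are isomorphic
    ([atomless_codings_iso]). Along such an isomorphism an action of a
    countable group becomes a genuine action after discarding an invariant null
    set ([transport_action]). *)

(** * Measurability of sets defined by countable formulas *)

Lemma measurable_preimageT d1 d2 (T1 : measurableType d1)
    (T2 : measurableType d2) (f : T1 -> T2) (A : set T2) :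
  measurable_fun setT f -> measurable A -> measurable (f @^-1` A).
Proof. by move=> mf mA; rewrite -[X in measurable X]setTI; exact: mf. Qed.

Section MeasurableFormulas.
Context d (T : measurableType d).
Implicit Types P Q : T -> Prop.

Lemma measurable_forall (F : nat -> T -> Prop) :
  (forall n, measurable [set x | F n x]) -> measurable [set x | forall n, F n x].
Proof.
move=> mF; rewrite (_ : [set _ | _] = \bigcap_n [set x | F n x]).
  by apply: bigcap_measurable => // n _; exact: mF.
by apply/seteqP; split => x /= h; [move=> n _; exact: h|move=> n; exact: h].
Qed.

Lemma measurable_exists (F : nat -> T -> Prop) :
  (forall n, measurable [set x | F n x]) -> measurable [set x | exists n, F n x].
Proof.
move=> mF; rewrite (_ : [set _ | _] = \bigcup_n [set x | F n x]).
  by apply: bigcup_measurable => // n _; exact: mF.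
by apply/seteqP; split => x /= [n]; [exists n|exists n].
Qed.

Lemma measurable_prop (p : Prop) : measurable [set x : T | p].
Proof.
have [hp|hp] := pselect p.
  by rewrite (_ : [set _ | _] = setT)//; apply/seteqP; split.
by rewrite (_ : [set _ | _] = set0)//; apply/seteqP; split.
Qed.

Lemma measurable_conj P Q : measurable [set x | P x] ->
  measurable [set x | Q x] -> measurable [set x | P x /\ Q x].
Proof. exact: measurableI. Qed.

Lemma measurable_imply P Q : measurable [set x | P x] ->
  measurable [set x | Q x] -> measurable [set x | P x -> Q x].
Proof.
move=> mP mQ; rewrite (_ : [set _ | _] = ~` [set x | P x] `|` [set x | Q x]).
  by apply: measurableU => //; exact: measurableC.
by apply/seteqP; split => x /=; have [] := pselect (P x); tauto.
Qed.

End MeasurableFormulas.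

(** * Measurable ternary coding of 0-1 sequences *)

(** Digits 0 and 2 only, as in the Cantor set: distinct 0-1 sequences then have
    values that are far enough apart for each digit to be read off by a
    measurable function of the value. *)
Section Ternary.
Variable R : realType.
Implicit Types c : nat -> bool.

Fixpoint ternary_sum (n : nat) c : R :=
  if n is m.+1 then (2 * (c 0%N)%:R + ternary_sum m (c \o S)) / 3 else 0.

Definition ternary c : R := limn (ternary_sum ^~ c).

Definition ternary_shift (r : R) : R := if 2^-1 <= r then 3 * r - 2 else 3 * r.

Definition ternary_digit (n : nat) : set R :=
  [set r | 2^-1 <= iter n ternary_shift r].

Lemma ternary_sum_itv n c : 0 <= ternary_sum n c <= 1.
Proof.
elim: n c => [|n IH] c /=; first by rewrite lexx ler01.
by have := IH (c \o S); case: (c 0%N) => /= ?; lra.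
Qed.

Lemma ternary_sum_nondecreasing c :
  {homo ternary_sum ^~ c : m n / (m <= n)%N >-> m <= n}.
Proof.
apply/nondecreasing_seqP => n; elim: n c => [|n IH] c /=.
  by case: (c 0%N) => /=; lra.
by have /= := IH (c \o S); case: (c 0%N) => /= ?; lra.
Qed.

Lemma ternary_cvg c : ternary_sum ^~ c @ \oo --> ternary c.
Proof.
apply: nondecreasing_is_cvgn; first exact: ternary_sum_nondecreasing.
by exists 1 => _ [n _ <-]; have /andP[] := ternary_sum_itv n c.
Qed.

Lemma ternary_itv c : 0 <= ternary c <= 1.
Proof.
have cc := @ternary_cvg c; apply/andP; split.
  by apply: (limr_ge (cvgP _ cc)); near=> n; have /andP[] := ternary_sum_itv n c.
by apply: (limr_le (cvgP _ cc)); near=> n; have /andP[] := ternary_sum_itv n c.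
Unshelve. all: by end_near. Qed.

Lemma ternaryS c : ternary c = (2 * (c 0%N)%:R + ternary (c \o S)) / 3.
Proof.
have cc := @ternary_cvg c; rewrite -cvg_shiftS in cc.
apply: (cvg_unique _ cc) => /=; first exact: Rhausdorff.
apply: cvgM; last exact: cvg_cst.
by apply: cvgD; [exact: cvg_cst|exact: ternary_cvg].
Qed.

Lemma ternary_ge_half c : (2^-1 <= ternary c) = c 0%N.
Proof.
rewrite ternaryS; have := ternary_itv (c \o S); case: (c 0%N) => /= ?.
  by apply/idP; lra.
by apply/negbTE; rewrite -ltNge; lra.
Qed.

Lemma ternary_shiftE c : ternary_shift (ternary c) = ternary (c \o S).
Proof.
rewrite /ternary_shift ternary_ge_half ternaryS.
by case: (c 0%N) => /=; field.
Qed.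

Lemma ternary_digitP c n : ternary_digit n (ternary c) <-> c n.
Proof.
rewrite /ternary_digit /=; elim: n c => [|n IH] c.
  by rewrite /= ternary_ge_half.
by rewrite iterSr ternary_shiftE IH.
Qed.

Lemma measurable_ternary_shift : measurable_fun setT ternary_shift.
Proof.
apply: measurable_fun_ifT => /=; last 2 first.
- by apply: measurable_funB => //; exact: measurable_funM.
- exact: measurable_funM.
exact: measurable_fun_ler.
Qed.

Lemma measurable_ternary_digit n : measurable (ternary_digit n).
Proof.
have mT : measurable_fun setT (iter n ternary_shift).
  elim: n => [|n IH]; first exact: measurable_id.
  rewrite [X in measurable_fun _ X](_ : _ = ternary_shift \o iter n ternary_shift)//.
  exact: measurableT_comp measurable_ternary_shift _.
rewrite /ternary_digit -[X in measurable X]setTI.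
have -> : [set r | 2^-1 <= iter n ternary_shift r] =
  iter n ternary_shift @^-1` `[2^-1, +oo[.
  by apply/seteqP; split => r /=; rewrite in_itv /= andbT.
exact: mT.
Qed.

Lemma measurable_ternary d (X : measurableType d) (c : X -> nat -> bool) :
  (forall n, measurable_fun setT (c ^~ n)) ->
  measurable_fun setT (fun x => ternary (c x)).
Proof.
move=> mc; apply: (@measurable_fun_cvg _ _ _ _ (fun n x => ternary_sum n (c x)));
  last first.
  by move=> x _; exact: ternary_cvg.
move=> m; elim: m c mc => [|m IH] c mc /=; first exact: measurable_cst.
apply: measurable_funM => //; apply: measurable_funD; last first.
  by apply: (IH (fun x => c x \o S)) => n; exact: mc.
apply: measurable_funM => //.
rewrite [X in measurable_fun _ X](_ : _ = fun x => if c x 0%N then 1 else 0 : R);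
  last first.
  by apply/funext => x; case: (c x 0%N).
exact: measurable_fun_ifT.
Qed.

End Ternary.

(** * Standard Borel spaces are retracts of the real line *)

Section PolishCode.
Variables (R : realType) (P : completePseudoMetricType R).

Lemma separable_countable_basis (D : set P) : countable D -> dense D ->
  exists U : nat -> set P, (forall n, open (U n)) /\
    forall x V, nbhs x V -> exists n, U n x /\ U n `<=` V.
Proof.
move=> cD dD.
have D0 : D != set0.
  by have [|x [_ Dx]] := dD setT _ openT; [exists point|apply/set0P; exists x].
have [e eD] : exists e : nat -> P, D `<=` range e.
  have /pfcard_geP[D0'|[e]] := cD; first by rewrite D0' eqxx in D0.
  by exists e => x /(@surj _ _ _ _ e)[n _ <-]; exists n.
pose U n := if unpickle n is Some ij then
  (ball (e ij.1) (ij.2.+1%:R^-1 : R))° else set0 : set P.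
exists U; split => [n|x V].
  by rewrite /U; case: (unpickle n) => [ij|]; [exact: open_interior|exact: open0].
move=> /nbhs_ballP[r /= r0 rV].
have [j] := @ltr_add_invr R 0 (r / 2) (divr_gt0 r0 (ltr0Sn R 1)).
rewrite add0r => jr.
set del : R := j.+1%:R^-1 in jr *.
have del0 : 0 < del / 2 by rewrite divr_gt0 ?invr_gt0.
have ballx : (ball x (del / 2))° !=set0 by exists x; exact: nbhsx_ballx.
have [y] := dD _ ballx (@open_interior _ _).
move=> [/interior_subset xy Dy]; have [i _ eiy] := eD y Dy; subst y.
exists (pickle (i, j)); rewrite /U pickleK /=; split.
  apply/nbhs_ballP; exists (del / 2) => //= z xz.
  by rewrite -/del (splitr del); apply: ball_triangle xz; exact: ball_sym.
move=> z /interior_subset iz; apply: rV; rewrite (splitr r).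
apply: ball_triangle (le_ball (ltW jr) iz).
apply: le_ball xy; rewrite (le_trans _ (ltW jr))// ler_pdivrMr//.
by rewrite ler_peMr ?ler1n// /del invr_ge0.
Qed.

Variable U : nat -> set P.
Hypothesis hP : hausdorff_space P.
Hypothesis oU : forall n, open (U n).
Hypothesis basisU : forall x V, nbhs x V -> exists n, U n x /\ U n `<=` V.

(** These conditions characterise the sets of indices [n | U n x] of the basic
    neighbourhoods of a point [x] without mentioning [x]. They only quantify
    over countable sets (the existence of the centre [p] does not depend on
    [c]), so they define a Borel set of sequences: this is how the range of the
    coding is seen to be measurable. *)
Definition basis_trace (c : nat -> Prop) : Prop :=
  [/\ forall n, c n -> U n !=set0,
      forall m n, c m -> c n -> exists l, c l /\ U l `<=` U m `&` U n,
      forall j : nat, exists n, c n /\ exists p, U n `<=` ball p (j.+1%:R^-1 : R) &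
      forall n, c n <-> exists m, c m /\ closure (U m) `<=` U n].

(** The first three conditions make the [U n] with [c n] a base of a Cauchy
    filter, which converges by completeness; the last one says that its limit
    lies in exactly those [U n], because it lies in all the closures and the
    space is regular. *)
Lemma basis_traceP (c : nat -> Prop) :
  basis_trace c <-> exists x, forall n, c n <-> U n x.
Proof.
split=> [[c_ne c_base c_small c_reg]|[x cx]]; last first.
  split.
  - by move=> n /cx Unx; exists x.
  - move=> m n /cx Umx /cx Unx.
    have [|l [lx lmn]] := @basisU x (U m `&` U n).
      by apply: filterI; apply: open_nbhs_nbhs.
    by exists l; split => //; apply/cx.
  - move=> j; have [|n [nx nb]] := @basisU x (ball x (j.+1%:R^-1 : R)).
      by apply: nbhsx_ballx; rewrite invr_gt0.
    by exists n; split; [exact/cx|exists x].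
  - move=> n; split=> [/cx Unx|[m [/cx Umx mn]]]; last first.
      by apply/cx/mn; exact: subset_closure.
    have [|V Vx VUn] := @uniform_regular P x (U n); first exact: open_nbhs_nbhs.
    have [m [mx mV]] := basisU Vx; exists m; split; first exact/cx.
    by apply: subset_trans VUn; exact: closureS.
pose F := filter_from [set n | c n] U.
have FF : ProperFilter F.
  apply: filter_from_proper; last exact: c_ne.
  apply: filter_from_filter; first by have [n [cn _]] := c_small 0%N; exists n.
  by move=> m n cm cn; have [l [cl lmn]] := c_base m n cm cn; exists l.
have cF : cvg F.
  apply: cauchy_cvg; apply: cauchy_exP => e e0.
  have [j] := @ltr_add_invr R 0 e e0; rewrite add0r => je.
  have [n [cn [p np]]] := c_small j; exists p; exists n => //.
  by apply: subset_trans np _; exact/le_ball/ltW.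
have Fx : F --> lim F by [].
exists (lim F) => n; split=> [/c_reg[m [cm]]|Unx].
  apply => B /Fx FB; apply: (@filter_ex _ F).
  by apply: filterI => //; exists m.
have [|V Vx VUn] := @uniform_regular P (lim F) (U n); first exact: open_nbhs_nbhs.
have [m cm mV] := Fx _ Vx; apply/c_reg; exists m; split => //.
by apply: subset_trans VUn; exact: closureS.
Qed.

Lemma basis_separates x y : (forall n, U n x <-> U n y) -> x = y.
Proof.
move=> xy; apply: hP => A B /basisU[m [mx mA]] By.
by exists y; split; [exact/mA/xy|exact: nbhs_singleton].
Qed.

Lemma open_basis_bigcup (V : set P) : open V ->
  V = \bigcup_(n in [set n | U n `<=` V]) U n.
Proof.
move=> oV; apply/seteqP; split=> [x Vx|x [n /= nV nx]]; last exact: nV.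
by have [|n [nx nV]] := @basisU x V; [exact: open_nbhs_nbhs|exists n].
Qed.

End PolishCode.

(** [h] is the ternary code of the basic open sets that contain a point. Its
    left inverse [s] decodes the reals whose digits are the trace of a point
    and is constant elsewhere; it is measurable because, among the reals that
    it decodes, the preimage of a basic open set is given by a single digit. *)
Lemma standard_borel_coding (R : realType) d (X : measurableType d) :
  standard_borel R X ->
  exists (h : X -> R) (s : R -> X),
    [/\ measurable_fun setT h, measurable_fun setT s, cancel h s &
        forall x, 0 <= h x <= 1].
Proof.
move=> [P [f [hP [D cD dD] [f' fK f'K] mX]]].
have [U [oU basisU]] := separable_countable_basis cD dD.
have imf A : f @` (f @^-1` A) = A.
  by apply/seteqP; split=> [_ [x Ax <-]//|y Ay]; exists (f' y); rewrite /= f'K.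
have imf' A : f @^-1` (f @` A) = A.
  by apply/seteqP; split=> [x [y Ay /(can_inj fK) <-]//|x Ax]; exists x.
have mfo V : open V -> measurable (f @^-1` V).
  by move=> oV; apply/mX; rewrite imf; exact: sub_sigma_algebra.
pose c x n := `[< U n (f x) >].
have mc n : measurable_fun setT (c ^~ n).
  apply: (measurable_fun_bool true); rewrite setTI.
  rewrite (_ : _ @^-1` _ = f @^-1` (U n)); first exact: mfo.
  by apply/seteqP; split => x /=; [move/asboolP|move=> ?; apply/asboolP].
pose h x := @ternary R (c x).
pose x0 := f' point.
pose E := [set r : R | basis_trace U (fun n => ternary_digit n r)].
have mE : measurable E.
  have mC n : measurable [set r : R | ternary_digit n r].
    exact: measurable_ternary_digit.
  rewrite (_ : E = [set r | (forall n, ternary_digit n r -> U n !=set0) /\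
    (forall m n, ternary_digit m r -> ternary_digit n r ->
       exists l, ternary_digit l r /\ U l `<=` U m `&` U n) /\
    (forall j : nat, exists n, ternary_digit n r /\
       exists p, U n `<=` ball p (j.+1%:R^-1 : R)) /\
    (forall n, (ternary_digit n r -> 
         exists m, ternary_digit m r /\ closure (U m) `<=` U n) /\
       ((exists m, ternary_digit m r /\ closure (U m) `<=` U n) ->
       ternary_digit n r))]); last first.
    by apply/seteqP; split => r /= => [[]|[? [? [? ?]]]]; split.
  by do ?[apply: measurable_forall => ?|apply: measurable_exists => ?
         |apply: measurable_imply|apply: measurable_conj|exact: mC
         |exact: measurable_prop].
have Epoint r : E r -> exists p, forall n, ternary_digit n r <-> U n p.
  by move=> /(basis_traceP oU basisU).
pose s r := if pselect (E r) is left Er then f' (projT1 (cid (Epoint r Er))) else x0.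
have sE r n : E r -> U n (f (s r)) <-> ternary_digit n r.
  by move=> Er; rewrite /s; case: pselect => // Er';
    case: cid => p /= pr; rewrite f'K pr.
have ms : measurable_fun setT s.
  pose G := [set A : set P | measurable [set r | A (f (s r))]].
  have sG : sigma_algebra setT G.
    split => [|A GA|A GA].
    - exact: measurable0.
    - by move: GA => /measurableC; rewrite /G setTD.
    - by have := bigcupT_measurable _ GA.
  have subG : <<s [set V : set P | open V] >> `<=` G.
    apply: smallest_sub => // V oV.
    rewrite (open_basis_bigcup basisU oV) /G /=.
    rewrite (_ : [set r | _] =
      \bigcup_(n in [set n | U n `<=` V]) [set r | U n (f (s r))])//.
    apply: bigcup_measurable => n _.
    rewrite (_ : [set r | _] = (E `&` @ternary_digit R n) `|`
       (~` E `&` [set r | U n (f x0)])); last first.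
      apply/seteqP; split => r /=.
        have [Er /sE|nEr] := pselect (E r); first by move=> /(_ Er); left.
        by rewrite /s; case: pselect => // _; right.
      by move=> [[Er /(sE r n Er)]|[nEr]] //; rewrite /s; case: pselect.
    apply: measurableU; apply: measurableI => //.
    - exact: measurable_ternary_digit.
    - exact: measurableC.
    - exact: measurable_prop.
  move=> _ A /mX/subG; rewrite setTI.
  by have -> : s @^-1` A = [set r | (f @` A) (f (s r))] by rewrite -{1}(imf' A).
exists h, s; split => //.
- exact: measurable_ternary.
- move=> x; have hd n : ternary_digit n (h x) <-> U n (f x).
    by rewrite ternary_digitP; split => /asboolP.
  have Ehx : E (h x) by apply/(basis_traceP oU basisU); exists (f x).
  apply: (can_inj fK); apply: (basis_separates hP basisU) => n.
  by rewrite sE// hd.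
- by move=> x; exact: ternary_itv.
Qed.

(** * Atomless laws and the isomorphism theorem *)

Section AtomlessLaw.
Context (R : realType) d (Y : measurableType d) (nu : probability Y R).
Variable h : Y -> R.
Hypothesis mh : measurable_fun setT h.
Hypothesis h01 : forall y, 0 <= h y <= 1.
Hypothesis h_atomless : forall r, nu (h @^-1` [set r]) = 0%E.

Let F (r : R) : R := fine (nu (h @^-1` `]-oo, r])).

Let mpre (A : set R) : measurable A -> measurable (h @^-1` A).
Proof. by move=> mA; rewrite -[X in measurable X]setTI; exact: mh. Qed.

Let FE r : nu (h @^-1` `]-oo, r]) = (F r)%:E.
Proof. by rewrite /F fineK// fin_num_measure//; exact: mpre. Qed.

Let F_nd : {homo F : r s / r <= s}.
Proof.
move=> r s rs; rewrite -lee_fin -!FE le_measure ?inE//; try exact: mpre.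
by apply: preimage_subset; exact: subset_itvl.
Qed.

Let F_itv r : 0 <= F r <= 1.
Proof.
by rewrite -!lee_fin -FE measure_ge0 probability_le1//; exact: mpre.
Qed.

Let F0 (r : R) : r < 0 -> F r = 0.
Proof.
move=> r0; apply: EFin_inj; rewrite -FE (_ : _ @^-1` _ = set0) ?measure0//.
apply/seteqP; split => // y /=; rewrite in_itv /= => hy.
by have /andP[] := h01 y; lra.
Qed.

Let F1 (r : R) : 1 <= r -> F r = 1.
Proof.
move=> r1; apply: EFin_inj; rewrite -FE (_ : _ @^-1` _ = setT) ?probability_setT//.
apply/seteqP; split => // y _ /=; rewrite in_itv /=.
by have /andP[] := h01 y; lra.
Qed.

Let mF : measurable_fun setT F.
Proof. exact: nondecreasing_measurable. Qed.

Let F_left (r u : R) : (forall s, s < r -> F s <= u) -> F r <= u.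
Proof.
move=> Fu; rewrite -lee_fin -FE.
pose A (n : nat) := h @^-1` `]-oo, r - n.+1%:R^-1].
have -> : nu (h @^-1` `]-oo, r]) = nu (\bigcup_n A n).
  have -> : h @^-1` `]-oo, r] = (\bigcup_n A n) `|` h @^-1` [set r].
    apply/seteqP; split => y /=.
      rewrite in_itv /= le_eqVlt => /orP[/eqP|hr]; first by right.
      left; have [n] := ltr_add_invr hr; rewrite -ltrBrDr => hn; exists n => //=.
      by rewrite /A /= in_itv /= ltW.
    move=> [[n _]|->]; last by rewrite in_itv /=.
    by rewrite /A /= !in_itv /= => hn; rewrite (le_trans hn)// gerBl invr_ge0.
  rewrite measureU0//; first by apply: bigcup_measurable => n _; exact: mpre.
    exact: mpre.
  exact: h_atomless.
have mA n : measurable (A n) by exact: mpre.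
have cv : nu (A n) @[n --> \oo] --> nu (\bigcup_n A n).
  apply: nondecreasing_cvg_mu => //; first exact: bigcup_measurable.
  move=> m n mn; apply/subsetPset; apply: preimage_subset; apply: subset_itvl.
  by rewrite bnd_simp lerD2l lerN2 lef_pV2 ?posrE// ler_nat.
rewrite -(cvg_lim _ cv)//; apply: lime_le; first exact: cvgP cv.
by apply: nearW => n; rewrite /A FE lee_fin Fu// gtrBl invr_gt0.
Qed.

Let F_right (r u : R) : (forall s, r < s -> u <= F s) -> u <= F r.
Proof.
move=> Fu; rewrite -lee_fin -FE.
pose A (n : nat) := h @^-1` `]-oo, r + n.+1%:R^-1].
have -> : h @^-1` `]-oo, r] = \bigcap_n A n.
  by rewrite /A -preimage_bigcap -itvNycEbigcap.
have mA n : measurable (A n) by exact: mpre.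
have cv : nu (A n) @[n --> \oo] --> nu (\bigcap_n A n).
  apply: nonincreasing_cvg_mu => //; last 1 first.
  - move=> m n mn; apply/subsetPset; apply: preimage_subset; apply: subset_itvl.
    by rewrite bnd_simp lerD2l lef_pV2 ?posrE// ler_nat.
  - by rewrite (le_lt_trans (probability_le1 _ _)) ?ltry.
  - exact: bigcap_measurable.
rewrite -(cvg_lim _ cv)//; apply: lime_ge; first exact: cvgP cv.
by apply: nearW => n; rewrite /A FE lee_fin Fu// ltrDl invr_gt0.
Qed.

(** The value of a continuous distribution function [F] at its own random
    variable is uniform: the set [F <= u] is a half-line that ends at a point
    where [F] takes the value [u]. *)
Lemma cdf_uniform u :
  nu ((F \o h) @^-1` `]-oo, u]) = (Num.min 1 (Num.max 0 u))%:E.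
Proof.
have [u1|u1] := leP 1 u.
  rewrite max_r ?(le_trans ler01)// min_l//.
  rewrite (_ : _ @^-1` _ = setT) ?probability_setT//.
  apply/seteqP; split => // y _ /=; rewrite in_itv /=.
  by have /andP[] := F_itv (h y); lra.
have [u0|u0] := ltP u 0.
  rewrite min_r// (_ : _ @^-1` _ = set0) ?measure0//.
  apply/seteqP; split => // y /=; rewrite in_itv /=.
  by have /andP[] := F_itv (h y); lra.
rewrite min_r ?ltW//.
pose I := [set r | F r <= u].
have I_ub : ubound I 1.
  by move=> r /= Fr; rewrite leNgt; apply/negP => /ltW r1;
    rewrite /I /= F1// in Fr; lra.
have I_ne : I !=set0 by exists (-1); rewrite /I /= F0// ltrN10.
have hsI : has_sup I by split => //; exists 1.
set S := sup I.
have S_lt r : r < S -> F r <= u.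
  by move=> /(sup_gt I_ne)[s Is rs]; exact: le_trans (F_nd (ltW rs)) Is.
have S_gt r : S < r -> u < F r.
  by move=> Sr; rewrite ltNge; apply/negP => Fr; 
    have := sup_upper_bound hsI Fr; rewrite leNgt Sr.
have FS : F S = u.
  by apply/eqP; rewrite eq_le F_left//= F_right// => s /S_gt/ltW.
rewrite -FS -FE; congr (nu _); apply/seteqP; split => y /=; rewrite !in_itv /=.
  by move=> Fu; rewrite leNgt; apply/negP => /S_gt; lra.
by rewrite FS => hS; rewrite -FS; exact: F_nd.
Qed.

(* The quantile function. The value 0 is always allowed in the supremum, so
   that the set is nonempty and Q is monotone on the whole line. *)
Let Q (u : R) := sup [set r | 0 <= r <= 1 /\ (r = 0 \/ F r < u)].

Let Qne u : [set r | 0 <= r <= 1 /\ (r = 0 \/ F r < u)] !=set0.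
Proof. by exists 0; split; [lra|left]. Qed.

Let Qsup u : has_sup [set r | 0 <= r <= 1 /\ (r = 0 \/ F r < u)].
Proof. by split => //; exists 1 => r /= [/andP[]]. Qed.

Let mQ : measurable_fun setT Q.
Proof.
apply: nondecreasing_measurable => // u v uv; apply: sup_le => // r [r01 rF].
exists r; split => //; split => //.
by case: rF => [|rF]; [left|right; exact: lt_le_trans uv].
Qed.

Let q (n : nat) : R := if unpickle n is Some x then ratr x else 0.

(** The quantile function fails to invert [F] at a point only if [F] is
    constant on an interval that ends there, hence on one that starts at a
    rational number; by [cdf_uniform] each such interval is null. *)
Lemma quantile_cdf : {ae nu, forall y, Q (F (h y)) = h y}.
Proof.
have null n : nu.-negligible [set y | q n < h y /\ F (h y) <= F (q n)].
  have mqn : measurable [set y | q n < h y /\ F (h y) <= F (q n)].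
    rewrite (_ : [set _ | _] = h @^-1` (`]q n, +oo[ `&` F @^-1` `]-oo, F (q n)])).
      by apply: mpre; apply: measurableI => //;
         exact: (measurable_preimageT mF).
    by apply/seteqP; split => y /=; rewrite !in_itv /= andbT.
  apply/negligibleP => //.
  have -> : [set y | q n < h y /\ F (h y) <= F (q n)] =
    (F \o h) @^-1` `]-oo, F (q n)] `\` h @^-1` `]-oo, q n].
    apply/seteqP; split => y /=; rewrite !in_itv /=.
      by move=> [qh ->]; split => //; apply/negP; rewrite -ltNge.
    by move=> [-> /negP]; rewrite -ltNge.
  rewrite measureD//; last 3 first.
  - by rewrite -[X in measurable X]setTI; apply: measurableT_comp.
  - exact: mpre.
  - by rewrite (le_lt_trans (probability_le1 _ _)) ?ltry//;
      rewrite -[X in measurable X]setTI; apply: measurableT_comp.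
  rewrite setIidr; last by move=> y /=; rewrite !in_itv /=; exact: F_nd.
  rewrite -[LHS]/(nu ((F \o h) @^-1` `]-oo, F (q n)]) - nu (h @^-1` `]-oo, q n]))%E.
  rewrite cdf_uniform FE; have /andP[q0 q1] := F_itv (q n).
  by rewrite max_r// min_r// subee.
apply: negligibleS (negligible_bigcup null) => y /= /eqP.
rewrite neq_lt => /orP[Qh|]; last first.
  rewrite ltNge => /negP; apply: contra_notP => _.
  apply: ge_sup => // r [r01 [->|]]; first by have /andP[] := h01 y.
  by rewrite ltNge => /negP Fr; rewrite leNgt; apply/negP => /ltW/F_nd.
have [x] := rat_in_itvoo Qh; rewrite in_itv /= => /andP[Qx xh].
exists (pickle x) => //=; rewrite /q pickleK; split => //.
rewrite leNgt; apply/negP => Fx.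
have : ratr x <= Q (F (h y)).
  apply: sup_upper_bound => //; split; last by right.
  have Q0 : 0 <= Q (F (h y)) by apply: sup_upper_bound => //; split; [lra|left].
  by have /andP[] := h01 y; lra.
by rewrite leNgt Qx.
Qed.

(** Only the values of the law of [f] on half-lines are recorded; they are
    those of the uniform law on the unit interval, whatever the space. *)
Lemma atomless_uniform (s : R -> Y) : measurable_fun setT s -> cancel h s ->
  exists (f : Y -> R) (g : R -> Y),
    [/\ measurable_fun setT f, measurable_fun setT g,
        {ae nu, forall y, g (f y) = y} &
        forall u, nu (f @^-1` `]-oo, u]) = (Num.min 1 (Num.max 0 u))%:E].
Proof.
move=> ms hs; exists (F \o h), (s \o Q); split.
- exact: measurableT_comp.
- exact: measurableT_comp.
- by move: quantile_cdf; apply: filterS => y /= ->.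
- exact: cdf_uniform.
Qed.

End AtomlessLaw.

Lemma ae_eq_measure d (T : measurableType d) (R : realType)
    (m : {measure set T -> \bar R}) (A B : set T) :
  measurable A -> measurable B -> {ae m, forall x, A x <-> B x} -> m A = m B.
Proof.
move=> mA mB [N [mN N0 sN]].
rewrite -(measureU0 mA mN N0) -(measureU0 mB mN N0); congr (m _).
apply/seteqP; split => x [h|]; try by right.
  have [Nx|Nx] := pselect (N x); first by right.
  by left; apply: contrapT => nB; apply/Nx/sN => -[/(_ h)].
have [Nx|Nx] := pselect (N x); first by right.
by left; apply: contrapT => nB; apply/Nx/sN => -[_ /(_ h)].
Qed.

Lemma rays_law_unique d1 d2 (T1 : measurableType d1) (T2 : measurableType d2)
    (R : realType) (m1 : probability T1 R) (m2 : probability T2 R)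
    (f1 : T1 -> R) (f2 : T2 -> R) :
  measurable_fun setT f1 -> measurable_fun setT f2 ->
  (forall u, m1 (f1 @^-1` `]-oo, u]) = m2 (f2 @^-1` `]-oo, u])) ->
  forall A, measurable A -> m1 (f1 @^-1` A) = m2 (f2 @^-1` A).
Proof.
move=> mf1 mf2 m12 A mA.
pose X1 : {mfun T1 >-> R} := mfun_Sub (mem_set mf1).
pose X2 : {mfun T2 >-> R} := mfun_Sub (mem_set mf2).
apply: (measure_unique (@RGenOInfty.G R) (fun k : nat => `]- k%:R, +oo[%classic)
  _ _ _ _ (distribution m1 X1) (distribution m2 X2)) => //.
- exact: RGenOInfty.measurableE.
- move=> _ _ [x ->] [y ->]; exists (Num.max x y).
  by apply/seteqP; split => z /=; rewrite !in_itv /= !andbT gt_max => /andP.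
- by move=> i; eexists.
- apply/seteqP; split => // z _; exists (Num.truncn (- z)).+1 => //=.
  by rewrite in_itv /= andbT ltrNl truncnS_gt.
- move=> _ [x ->] /=; rewrite /distribution /pushforward /= -setCitvl.
  rewrite !preimage_setC !probability_setC ?m12//.
    by apply: (@measurable_preimageT _ _ _ _ f2 `]-oo, x]).
  by apply: (@measurable_preimageT _ _ _ _ f1 `]-oo, x]).
- by move=> k; rewrite (le_lt_trans (probability_le1 _ _)) ?ltry.
Qed.

(** Going through the common law on the line. The identity [f2 (g2 r) = r]
    holds for almost all [r] for the law of [f2], which is also the law of
    [f1]; this is why it may be used at [r = f1 y]. *)
Lemma uniform_codings_iso (R : realType) d1 d2
    (T1 : measurableType d1) (T2 : measurableType d2)
    (m1 : probability T1 R) (m2 : probability T2 R)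
    (f1 : T1 -> R) (g1 : R -> T1) (f2 : T2 -> R) (g2 : R -> T2) :
  measurable_fun setT f1 -> measurable_fun setT g1 ->
  measurable_fun setT f2 -> measurable_fun setT g2 ->
  {ae m1, forall y, g1 (f1 y) = y} -> {ae m2, forall y, g2 (f2 y) = y} ->
  (forall A, measurable A -> m1 (f1 @^-1` A) = m2 (f2 @^-1` A)) ->
  [/\ forall A, measurable A -> m1 ((g2 \o f1) @^-1` A) = m2 A &
      {ae m1, forall y, g1 (f2 (g2 (f1 y))) = y}].
Proof.
move=> mf1 mg1 mf2 mg2 gf1 gf2 law; split.
  move=> A mA; rewrite comp_preimage law; last exact: measurable_preimageT.
  apply: ae_eq_measure => //.
    by apply: measurable_preimageT => //; exact: measurable_preimageT.
  by apply: filterS gf2 => y /= ->.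
pose B := [set r | f2 (g2 r) = r].
have mB : measurable B.
  rewrite (_ : B = (fun r => f2 (g2 r) == r) @^-1` [set true]).
    apply: measurable_preimageT => //; apply: measurable_fun_eqr => //.
    exact: measurableT_comp.
  by apply/seteqP; split => r /eqP.
have nB : m1 (f1 @^-1` (~` B)) = 0%E.
  rewrite law; last exact: measurableC.
  rewrite -(@measure0 _ _ _ m2); apply: ae_eq_measure => //.
    by apply: measurable_preimageT => //; exact: measurableC.
  by apply: filterS gf2 => y e; split => //; rewrite /B /= e.
have aeB : {ae m1, forall y, B (f1 y)}.
  exists (f1 @^-1` (~` B)); split => //.
  by apply: measurable_preimageT => //; exact: measurableC.
by apply: filterS2 gf1 aeB => y e Bf; rewrite Bf.
Qed.

Lemma atomless_codings_iso (R : realType) d1 d2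
    (T1 : measurableType d1) (T2 : measurableType d2)
    (m1 : probability T1 R) (m2 : probability T2 R)
    (h1 : T1 -> R) (s1 : R -> T1) (h2 : T2 -> R) (s2 : R -> T2) :
  measurable_fun setT h1 -> measurable_fun setT s1 -> cancel h1 s1 ->
  (forall y, 0 <= h1 y <= 1) -> (forall r, m1 (h1 @^-1` [set r]) = 0%E) ->
  measurable_fun setT h2 -> measurable_fun setT s2 -> cancel h2 s2 ->
  (forall y, 0 <= h2 y <= 1) -> (forall r, m2 (h2 @^-1` [set r]) = 0%E) ->
  exists phi, prob_iso m1 m2 phi.
Proof.
move=> mh1 ms1 hs1 b1 a1 mh2 ms2 hs2 b2 a2.
have [f1 [g1 [mf1 mg1 gf1 u1]]] := atomless_uniform mh1 b1 a1 ms1 hs1.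
have [f2 [g2 [mf2 mg2 gf2 u2]]] := atomless_uniform mh2 b2 a2 ms2 hs2.
have law := @rays_law_unique _ _ _ _ _ m1 m2 f1 f2 mf1 mf2
  (fun u => etrans (u1 u) (esym (u2 u))).
have [p12 i1] := uniform_codings_iso mf1 mg1 mf2 mg2 gf1 gf2 law.
have [p21 i2] := uniform_codings_iso mf2 mg2 mf1 mg1 gf2 gf1
  (fun A mA => esym (law A mA)).
exists (g2 \o f1); split => //; first exact: measurableT_comp.
exists (g1 \o f2); split => //; exact: measurableT_comp.
Qed.

Lemma nonatomic_fiber (R : realType) d (X : measurableType d)
    (mu : probability X R) (h : X -> R) : nonatomic mu ->
  measurable_fun setT h -> injective h -> forall r, mu (h @^-1` [set r]) = 0%E.
Proof.
move=> na mh ih r; apply/eqP/negPn/negP => n0.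
have mr : measurable (h @^-1` [set r]) by exact: measurable_preimageT.
have [|B [mB Br B0]] := na _ mr; first by rewrite lt_neqAle eq_sym n0 measure_ge0.
have /set0P[x Bx] : B != set0.
  by apply/eqP => B00; rewrite B00 measure0 ltxx in B0.
rewrite (_ : B = h @^-1` [set r]) ?ltxx//; apply/seteqP; split => // y /= hy.
by rewrite (_ : y = x)//; apply: ih; rewrite hy (Br _ Bx).
Qed.

(** The codes of the two copies are put in the disjoint intervals [[2/3, 1]]
    and [[0, 1/3]]. *)
Lemma two_copies_iso (R : realType) d (X : measurableType d)
    (mu : probability X R) (t : R) : standard_probability mu -> 0 <= t <= 1 ->
  exists phi, prob_iso (two_copies mu t) mu phi.
Proof.
move=> [sX na] t01; have [h [s [mh ms hs h01]]] := standard_borel_coding sX.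
pose h' (z : bool * X) : R := if z.1 then (2 + h z.2) / 3 else h z.2 / 3.
pose s' (r : R) := if 2^-1 <= r then (true, s (3 * r - 2)) else (false, s (3 * r)).
have h'01 z : 0 <= h' z <= 1 by rewrite /h'; have := h01 z.2; case: z.1; lra.
have mh' : measurable_fun setT h'.
  have mhs : measurable_fun setT (fun z : bool * X => h z.2).
    exact: measurableT_comp.
  apply: measurable_fun_ifT => //; apply: measurable_funM => //.
  exact: measurable_funD.
have hs' : cancel h' s'.
  move=> [b x]; rewrite /s' /h' /=; have := h01 x; case: b => /= hx.
    by rewrite ifT; [rewrite [X in s X](_ : _ = h x) ?hs//; field|lra].
  by rewrite ifF; [rewrite [X in s X](_ : _ = h x) ?hs//; field|
                   apply/negbTE; rewrite -ltNge; lra].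
have ms' : measurable_fun setT s'.
  apply: measurable_fun_ifT; first exact: measurable_fun_ler.
    apply: measurable_fun_pair => //; apply: measurableT_comp => //.
    by apply: measurable_funB => //; exact: measurable_funM.
  apply: measurable_fun_pair => //; apply: (measurableT_comp ms).
  exact: measurable_funM.
have a := nonatomic_fiber na mh (can_inj hs).
apply: (@atomless_codings_iso _ _ _ _ _ (bernoulli_prob t \x mu)%E mu
  _ _ _ _ mh' ms' hs' h'01 _ mh ms hs h01 a) => r.
rewrite -[LHS]/(two_copies mu t _) two_copiesE//; last exact: measurable_preimageT.
rewrite [X in (_ * mu X + _)%E](_ : _ = h @^-1` [set 3 * r - 2]); last first.
  by apply/seteqP; split => x /=; rewrite /h' /=; [move=> <-; field|move=> ->; field].
rewrite [X in (_ + _ * mu X)%E](_ : _ = h @^-1` [set 3 * r]); last first.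
  by apply/seteqP; split => x /=; rewrite /h' /=; [move=> <-; field|move=> ->; field].
by rewrite !a !mule0 adde0.
Qed.

(** * Existence of convex combinations *)

(** The identities that define an action must hold everywhere, while [phi] and
    [psi] are inverse to each other almost everywhere only. As the group is
    countable, the points whose whole orbit avoids a null set form an invariant
    set of full measure; the action is transported there and is the identity on
    the rest. The injective map [h] makes the set [phi (psi x) = x]
    measurable. *)
Lemma transport_action (G : groupType) (gam : nat -> G) (R : realType)
    d1 d2 (Y : measurableType d1) (X : measurableType d2)
    (nu : {measure set Y -> \bar R}) (mu : {measure set X -> \bar R})
    (phi : Y -> X) (h : X -> R) (s : mp_action G nu) :
  range gam = [set: G] -> measurable_fun setT h -> injective h ->
  prob_iso nu mu phi -> exists c : mp_action G mu, transported phi s c.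
Proof.
move=> gamT mh ih [mphi phi_mu [psi [mpsi psi_nu psiphi phipsi]]].
have gamE (P : G -> Prop) : (forall n, P (gam n)) -> forall g, P g.
  by move=> Pg g; have [n _ <-] : range gam g by rewrite gamT.
have [N [mN N0 subN]] := psiphi.
pose Y0 := [set y | forall n, ~ N (s (gam n) y)].
have mY0 : measurable Y0.
  rewrite /Y0; apply: (@measurable_forall _ _ (fun n y => ~ N (s (gam n) y))) => n.
  apply: measurableC.
  exact: (measurable_preimageT (measurable_act s (gam n))).
pose X0 := [set x | Y0 (psi x) /\ phi (psi x) = x].
have mX0 : measurable X0.
  apply: (@measurable_conj _ _ (fun x => Y0 (psi x))
    (fun x => phi (psi x) = x)); first exact: (measurable_preimageT mpsi).
  rewrite (_ : [set x | _] = (fun x => h (phi (psi x)) == h x) @^-1` [set true]).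
    apply: measurable_preimageT => //; apply: measurable_fun_eqr => //.
    exact: (measurableT_comp mh (measurableT_comp mphi mpsi)).
  by apply/seteqP; split => x /=; [move=> ->; rewrite eqxx|move/eqP/ih].
have Y0_psi y : Y0 y -> psi (phi y) = y.
  move=> Y0y; have /(_ 1%g) := gamE (fun g => ~ N (s g y)) Y0y.
  by rewrite act1; move=> Ny; apply: contrapT => ne; exact/Ny/subN.
have Y0_s y g : Y0 y -> Y0 (s g y).
  move=> Y0y n; rewrite -actM.
  exact: (gamE (fun g => ~ N (s g y)) Y0y).
have Y0_phi y : Y0 y -> X0 (phi y).
  by move=> Y0y; rewrite /X0 /= (Y0_psi y Y0y).
have aeY0 : {ae nu, forall y, Y0 y}.
  apply: (@ae_foralln _ _ _ nu (fun n y => ~ N (s (gam n) y))) => n.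
  exists (s (gam n) @^-1` N); split => //.
  - exact: (measurable_preimageT (measurable_act s (gam n))).
  - by rewrite act_preserving.
  - by move=> y /= /contrapT.
have aeX0 : {ae mu, forall x, X0 x}.
  have aeY0' : {ae mu, forall x, Y0 (psi x)}.
    exists (psi @^-1` (~` Y0)); split => //.
    - by apply: measurable_preimageT => //; exact: measurableC.
    - rewrite psi_nu; last exact: measurableC.
      rewrite -(@measure0 _ _ _ nu); apply: ae_eq_measure => //.
        exact: measurableC.
      by apply: filterS aeY0 => y Y0y; split.
  by apply: filterS2 aeY0' phipsi => x.
pose c g x := if `[< X0 x >] then phi (s g (psi x)) else x.
have cE g x : X0 x -> c g x = phi (s g (psi x)).
  by move=> X0x; rewrite /c ifT//; exact/asboolP.
have cN g x : ~ X0 x -> c g x = x.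
  by move=> X0x; rewrite /c ifF//; exact/asboolPn.
have c1 x : c 1%g x = x.
  have [X0x|X0x] := pselect (X0 x); last exact: cN.
  by rewrite cE// act1; case: X0x.
have cM g k x : c (g * k)%g x = c g (c k x).
  have [X0x|X0x] := pselect (X0 x); last by rewrite !cN// cN.
  have Y0x : Y0 (s k (psi x)) by apply: Y0_s; case: X0x.
  by rewrite (cE k)// !cE ?Y0_psi ?actM//; exact: Y0_phi.
have mX0b : measurable_fun setT (fun x => `[< X0 x >]).
  apply: (measurable_fun_bool true); rewrite setTI.
  rewrite (_ : _ @^-1` _ = X0)//.
  by apply/seteqP; split => x /=; [move/asboolP|move=> ?; apply/asboolP].
have mpsp g : measurable_fun setT (fun x => phi (s g (psi x))).
  by apply: measurableT_comp => //; apply: measurableT_comp (measurable_act s g) _.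
have mc g : measurable_fun setT (c g) by exact: measurable_fun_ifT.
have cp g (A : set X) : measurable A -> mu (c g @^-1` A) = mu A.
  move=> mA; rewrite -[RHS]phi_mu//.
  rewrite -[RHS](act_preserving s g); last exact: (measurable_preimageT mphi).
  rewrite -[RHS]psi_nu.
    apply: ae_eq_measure.
    - exact: (measurable_preimageT (mc g)).
    - exact: (measurable_preimageT (mpsp g)).
    - by apply: filterS aeX0 => x X0x; rewrite /= cE.
  apply: (measurable_preimageT (measurable_act s g)).
  exact: (measurable_preimageT mphi).
exists (MpAction c1 cM mc cp) => g.
by apply: filterS aeY0 => y Y0y /=; rewrite cE ?Y0_psi//; exact: Y0_phi.
Qed.

Lemma convex_combP (G : groupType) (R : realType) d (X : measurableType d)
    (mu : probability X R) (gam : nat -> G) (t : R) (x y : wclass G mu) :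
  standard_probability mu -> range gam = [set: G] -> 0 <= t <= 1 ->
  is_convex_comb t x y (convex_comb t x y).
Proof.
move=> sX gamT t01; apply: xgetPex.
have [phi phi_iso] := two_copies_iso sX t01.
have [h [r [mh _ hr _]]] := standard_borel_coding sX.1.
have [c cP] := transport_action (sum_action t (repr x) (repr y)) gamT mh
  (can_inj hr) phi_iso.
exists (\pi_(wclass G mu) c)%qT, (repr x), (repr y), c, phi.
by split => //; rewrite reprK.
Qed.

(** * Rounding almost-partitions *)

Lemma bigsetU_ordP T k (P : pred 'I_k) (F : 'I_k -> set T) x :
  (\big[setU/set0]_(i < k | P i) F i) x <-> exists2 i, P i & F i x.
Proof.
rewrite -bigcup_seq_cond; split=> [[i /= /andP[_ Pi] Fx]|[i Pi Fx]]; exists i => //=.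
by rewrite mem_index_enum.
Qed.

Section RealMeasure.
Context (R : realType) d (T : measurableType d) (mu : probability T R).
Implicit Types A B C : set T.
Local Notation m A := (fine (mu A)).

Let mfin A : measurable A -> mu A \is a fin_num.
Proof. by move=> mA; exact: fin_num_measure. Qed.

Lemma prob_mono A B : measurable A -> measurable B -> A `<=` B -> m A <= m B.
Proof. by move=> mA mB AB; rewrite fine_le ?mfin// le_measure ?inE. Qed.

Lemma probU A B : measurable A -> measurable B -> m (A `|` B) <= m A + m B.
Proof.
move=> mA mB; rewrite -lee_fin EFinD !fineK ?mfin//; last exact: measurableU.
by rewrite measureU2.
Qed.

Lemma prob_setD A B : measurable A -> measurable B ->
  m A = m (A `&` B) + m (A `\` B).
Proof.
move=> mA mB; rewrite -fineD ?mfin//; [|exact: measurableI|exact: measurableD].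
by rewrite addeC -measureDI.
Qed.

Lemma prob_dist A B : measurable A -> measurable B ->
  `|m A - m B| <= m (A `\` B) + m (B `\` A).
Proof.
move=> mA mB; rewrite (prob_setD mA mB) (prob_setD mB mA) (setIC B A).
have := fine_ge0 (measure_ge0 mu (A `\` B)).
have := fine_ge0 (measure_ge0 mu (B `\` A)).
by move=> ? ?; rewrite ler_norml; lra.
Qed.

Lemma prob_bigU k (P : pred 'I_k) (F : 'I_k -> set T) :
  (forall i, measurable (F i)) ->
  m (\big[setU/set0]_(i < k | P i) F i) <= \sum_(i < k | P i) m (F i).
Proof.
move=> mF; suff [] : measurable (\big[setU/set0]_(i < k | P i) F i) /\
  m (\big[setU/set0]_(i < k | P i) F i) <= \sum_(i < k | P i) m (F i) by [].
elim/big_ind2 : _ => [|A x B y [mA Ax] [mB By]|i Pi //].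
  by split; rewrite ?measure0.
by split; [exact: measurableU|apply: le_trans (probU mA mB) _; exact: lerD].
Qed.

Lemma prob_sum_disjoint k (F : 'I_k -> set T) : (forall i, measurable (F i)) ->
  trivIset setT F -> m (\big[setU/set0]_(i < k) F i) = \sum_(i < k) m (F i).
Proof.
by move=> mF tF; rewrite measure_bigsetU_ord// -sum_fine// => i _; exact: mfin.
Qed.

Lemma prob_sum_partition k (A : 'I_k -> set T) : measurable_partition A ->
  \sum_(i < k) m (A i) = 1.
Proof.
move=> [mA tA cA]; rewrite -prob_sum_disjoint//.
rewrite (_ : \big[_/_]_(i < k) _ = setT) ?probability_setT//.
apply/seteqP; split => // x _; have [i _ Aix] : (\bigcup_i A i) x by rewrite cA.
by apply/bigsetU_ordP; exists i.
Qed.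

(** If the [B i] almost form a partition, let each point go to the first [B i]
    that contains it, and the points in no [B i] to the first piece. The points
    that leave [B i] lie in some [B i `&` B j], and the uncovered part is small
    because the measures of the [B i] almost add up to 1. *)
Lemma near_partition k (B : 'I_k.+1 -> set T) (del : R) :
  (forall i, measurable (B i)) -> 0 <= del ->
  (forall i j, i != j -> m (B i `&` B j) <= del) ->
  1 - k.+1%:R * del <= \sum_(i < k.+1) m (B i) ->
  exists2 C : 'I_k.+1 -> set T, measurable_partition C &
    forall i, m (B i `\` C i) + m (C i `\` B i) <=
      (k.+1%:R ^+ 2 + 2 * k.+1%:R) * del.
Proof.
move=> mB del0 Bdel Bsum; set K : R := k.+1%:R.
pose U (i : 'I_k.+1) := \big[setU/set0]_(j < k.+1 | (j < i)%N) B j.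
pose D i := B i `\` U i.
pose L := ~` \big[setU/set0]_(j < k.+1) B j.
pose C i := D i `|` (if i == ord0 then L else set0).
have mbig P : measurable (\big[setU/set0]_(j < k.+1 | P j) B j).
  by apply: bigsetU_measurable => i _.
have mD i : measurable (D i) by apply: measurableD => //; exact: mbig.
have mL : measurable L by apply: measurableC; exact: mbig.
have mC i : measurable (C i) by apply: measurableU => //; case: ifP.
have Dex x : (exists i, B i x) -> exists i, D i x.
  move=> [i0 Bx]; have B0 : `[< B i0 x >] by exact/asboolP.
  case: (@arg_minnP _ i0 (fun i => `[< B i x >]) val B0) => i /asboolP Bix imin.
  exists i; split => // /bigsetU_ordP[j ji Bjx].
  by have := imin j (asboolT Bjx); rewrite /= leqNgt ji.
have Ddisj i j x : D i x -> D j x -> i = j.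
  move=> [Bi nUi] [Bj nUj]; have [lt|lt|/val_inj//] := ltngtP i j.
    by exfalso; apply: nUj; apply/bigsetU_ordP; exists i.
  by exfalso; apply: nUi; apply/bigsetU_ordP; exists j.
have nL i x : L x -> ~ B i x.
  by move=> Lx Bx; apply: Lx; apply/bigsetU_ordP; exists i.
have tD : trivIset setT D.
  by apply/trivIsetP => i j _ _ ij; apply/seteqP; split => // x [Di Dj];
     move: ij; rewrite (Ddisj _ _ _ Di Dj) eqxx.
have BD i : m (B i `\` D i) <= K * del.
  have -> : B i `\` D i = B i `&` U i.
    by rewrite /D setDD.
  apply: (@le_trans _ _
    (m (\big[setU/set0]_(j < k.+1 | (j < i)%N) (B i `&` B j)))).
 
    apply: prob_mono.
    - by apply: measurableI => //; exact: mbig.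
    - by apply: bigsetU_measurable => j _; exact: measurableI.
    - by move=> x [Bx /bigsetU_ordP[j ji Bj]]; apply/bigsetU_ordP; exists j.
  apply: le_trans (prob_bigU _ _) _; first by move=> j; exact: measurableI.
  apply: (@le_trans _ _ (\sum_(j < k.+1 | (j < i)%N) del)).
    by apply: ler_sum => j ji; apply: Bdel; rewrite neq_ltn ji orbT.
  apply: (@le_trans _ _ (\sum_(j < k.+1) del)).
    by rewrite big_mkcond /=; apply: ler_sum => j _; case: ifP.
  by rewrite sumr_const card_ord -mulr_natl.
have Lle : m L <= K * del + K ^+ 2 * del.
  have totL : m L = 1 - m (\big[setU/set0]_(j < k.+1) D j).
    rewrite (_ : \big[_/_]_(j < k.+1) D j = ~` L).
      by rewrite probability_setC// fineB ?mfin//= opprB addrC subrK.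
    apply/seteqP; split => x.
      by move=> /bigsetU_ordP[i _ [Bi _]] Lx; exact: (nL i x Lx Bi).
    move=> /contrapT/bigsetU_ordP[i _ Bi].
    have [|j Dj] := Dex x; first by exists i.
    by apply/bigsetU_ordP; exists j.
  rewrite totL prob_sum_disjoint//.
  have : \sum_(i < k.+1) m (B i) <= \sum_(i < k.+1) (m (D i) + K * del).
    apply: ler_sum => i _; rewrite (prob_setD (mB i) (mD i)) lerD//.
    by apply: prob_mono => //; exact: measurableI.
  rewrite big_split /= sumr_const card_ord -[X in _ + X]mulr_natl.
  by move: Bsum; rewrite -/K; lra.
exists C.
  split => //.
    apply/trivIsetP => i j _ _ ij; apply/seteqP; split => // x [].
    rewrite /C /=; case: eqP => [i0|_]; case: eqP => [j0|_];
      try by move: ij; rewrite i0 j0 eqxx.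
    - by move=> [Di|Lx] [Dj|//];
        [move: ij; rewrite (Ddisj _ _ _ Di Dj) eqxx|case: Dj => /(nL _ _ Lx)].
    - by move=> [Di|//] [Dj|Lx];
        [move: ij; rewrite (Ddisj _ _ _ Di Dj) eqxx|case: Di => /(nL _ _ Lx)].
    - by move=> [Di|//] [Dj|//]; move: ij; rewrite (Ddisj _ _ _ Di Dj) eqxx.
  apply/seteqP; split => // x _.
  have [/Dex[i Di]|nB] := pselect (exists i, B i x); first by exists i => //; left.
  exists ord0 => //; right => /=; move/bigsetU_ordP => [i _ Bi].
  by apply: nB; exists i.
move=> i.
have : m (B i `\` C i) <= K * del.
  apply: le_trans (BD i); apply: prob_mono; [exact: measurableD|exact: measurableD|].
  by move=> x [Bx nC]; split => // Dx; apply: nC; left.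
have : m (C i `\` B i) <= K * del + K ^+ 2 * del.
  apply: le_trans Lle; apply: prob_mono => //; first exact: measurableD.
  by move=> x [[[Bx _] //|]]; case: ifP.
by nra.
Qed.

End RealMeasure.

(** * Correlations and simulation of actions *)

Section ActionImage.
Context (G : groupType) (R : realType) d (Y : measurableType d).
Context (nu : {measure set Y -> \bar R}) (s : mp_action G nu).

Lemma act_image g (A : set Y) : s g @` A = s g^-1%g @^-1` A.
Proof.
apply/seteqP; split => [_ [y Ay <-] /=|y Ay].
  by rewrite -actM mulVg act1.
by exists (s g^-1%g y) => //; rewrite -actM mulgV act1.
Qed.

Lemma measurable_act_image g (A : set Y) : measurable A -> measurable (s g @` A).
Proof.
by move=> mA; rewrite act_image; exact: (measurable_preimageT (measurable_act s _)).
Qed.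

Lemma measure_act_image g (A : set Y) : measurable A -> nu (s g @` A) = nu A.
Proof. by move=> mA; rewrite act_image act_preserving. Qed.

Lemma ae_act g (P : Y -> Prop) :
  {ae nu, forall y, P y} -> {ae nu, forall y, P (s g y)}.
Proof.
move=> [N [mN N0 sN]]; exists (s g @^-1` N); split.
- exact: (measurable_preimageT (measurable_act s g)).
- by rewrite act_preserving.
- by move=> y nP; exact: sN.
Qed.

Definition corr g (A B : set Y) : R := fine (nu ((s g @` A) `&` B)).

End ActionImage.

Section Simulation.
Context (G : groupType) (R : realType) (gam : nat -> G).

(** One half of the comparison of correlation sets by the Hausdorff distance;
    the actions may live on different spaces. *)
Definition simulates d1 (X : measurableType d1) (mu : probability X R)
    d2 (Y : measurableType d2) (nu : probability Y R) (n k : nat) (e : R)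
    (a : mp_action G mu) (b : mp_action G nu) : Prop :=
  forall A : 'I_k -> set X, measurable_partition A ->
  exists2 B : 'I_k -> set Y, measurable_partition B &
    forall (p : 'I_n) q r,
      `|corr a (gam p) (A q) (A r) - corr b (gam p) (B q) (B r)| < e.

Lemma simulates_trans d1 (X : measurableType d1) (mu : probability X R)
    d2 (Y : measurableType d2) (nu : probability Y R)
    d3 (Z : measurableType d3) (xi : probability Z R) n k e f
    (a : mp_action G mu) (b : mp_action G nu) (c : mp_action G xi) :
  simulates n k e a b -> simulates n k f b c -> simulates n k (e + f) a c.
Proof.
move=> ab bc A /ab[B /bc[C pC BC] AB]; exists C => // p q r.
by apply: le_lt_trans (ler_distD (corr b (gam p) (B q) (B r)) _ _) _; exact: ltrD.
Qed.

Lemma corr_perturb d (Y : measurableType d) (nu : probability Y R)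
    (b : mp_action G nu) g (A A' B B' : set Y) :
  measurable A -> measurable A' -> measurable B -> measurable B' ->
  `|corr b g A A' - corr b g B B'| <=
    (fine (nu (A `\` B)) + fine (nu (B `\` A))) +
    (fine (nu (A' `\` B')) + fine (nu (B' `\` A'))).
Proof.
move=> mA mA' mB mB'.
have half (C C' D D' : set Y) : measurable C -> measurable C' ->
    measurable D -> measurable D' ->
    fine (nu ((b g @` C `&` C') `\` (b g @` D `&` D'))) <=
    fine (nu (C `\` D)) + fine (nu (C' `\` D')).
  move=> mC mC' mD mD'.
  have m1 : measurable (b g @` (C `\` D)).
    by apply: measurable_act_image; exact: measurableD.
  have m2 : measurable (C' `\` D') by exact: measurableD.
  rewrite -[in X in _ <= X + _](measure_act_image b g); last exact: measurableD.
  apply: le_trans (probU nu m1 m2); apply: prob_mono.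
  - by apply: measurableD; apply: measurableI => //; exact: measurable_act_image.
  - exact: measurableU.
  move=> y [[bC C'y]]; rewrite !act_image /= in bC *.
  move=> nD; have [Dy|nDy] := pselect (D (b g^-1%g y)); last by left.
  by right; split => // D'y; apply: nD; split.
apply: le_trans (prob_dist _ _ _) _; 
  try (apply: measurableI => //; exact: measurable_act_image).
by have := half A A' B B' mA mA' mB mB'; have := half B B' A A' mB mB' mA mA'; lra.
Qed.

Lemma corr_id d (Y : measurableType d) (nu : probability Y R)
    (b : mp_action G nu) (A B : set Y) : corr b 1%g A B = fine (nu (A `&` B)).
Proof.
rewrite /corr act_image invg1; congr (fine (nu (_ `&` _))).
by apply/seteqP; split => y /=; rewrite act1.
Qed.

(** Weak containment supplies arbitrary sets instead of a partition. Asked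
    about the identity of the group, it makes these sets almost disjoint and of
    almost the right measures, so that they are close to a partition. *)
Lemma weakly_contained_simulates d1 (X : measurableType d1) (mu : probability X R)
    d2 (Y : measurableType d2) (nu : probability Y R)
    (a : mp_action G mu) (b : mp_action G nu) n k e :
  weakly_contained a b -> 0 < e -> simulates n k.+1 e a b.
Proof.
move=> ab e0 A pA; have [mA tA cA] := pA.
pose K : R := k.+1%:R; have K0 : 1 <= K by rewrite ler1n.
(* One [del] for the matching by the sets [B i], and [K ^+ 2 + 2 * K] of them
   for each of the two sets of a correlation that [near_partition] replaces. *)
pose D := 1 + 2 * (K ^+ 2 + 2 * K); have D0 : 0 < D by rewrite /D; nra.
pose del := e / D; have del0 : 0 < del by exact: divr_gt0.
have fF : finite_set ([set 1%g] `|` range (fun p : 'I_n => gam p)).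
  by rewrite finite_setU; split => //; exact: finite_image.
have [B [mB AB]] := ab _ A _ del mA fF del0.
have AB1 i j : `|fine (mu (A i `&` A j)) - fine (nu (B i `&` B j))| < del.
  by have := AB 1%g i j (or_introl erefl); rewrite -!/(corr _ _ _ _) !corr_id.
have [||C pC BC] := @near_partition _ _ _ nu k B del mB (ltW del0).
- move=> i j ij; have := AB1 i j.
  have -> : A i `&` A j = set0 by move/trivIsetP : tA; apply.
  by rewrite measure0 sub0r normrN => /ltW; exact/le_trans/ler_norm.
- have -> : 1 - K * del = \sum_(i < k.+1) (fine (mu (A i)) - del).
    rewrite sumrB (prob_sum_partition mu pA) sumr_const card_ord.
    by rewrite -[in RHS]mulr_natl.
  by apply: ler_sum => i _; have := AB1 i i; rewrite !setIid ltr_norml; lra.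
have mC i : measurable (C i) by case: pC.
exists C => // p q r.
have h1 : `|corr a (gam p) (A q) (A r) - corr b (gam p) (B q) (B r)| < del.
  by apply: AB; right; exists p.
have h2 := corr_perturb b (gam p) (mB q) (mB r) (mC q) (mC r).
apply: le_lt_trans (ler_distD (corr b (gam p) (B q) (B r)) _ _) _.
have -> : e = D * del by rewrite /del mulrC divfK// gt_eqF.
have := BC q; have := BC r; rewrite -/K /D.
by move: h1 h2; lra.
Qed.

End Simulation.

(** * Convex combinations of simulations *)

Lemma measurable_partition_preimage d1 d2 (Y : measurableType d1)
    (X : measurableType d2) (f : Y -> X) k (A : 'I_k -> set X) :
  measurable_fun setT f ->
  measurable_partition A -> measurable_partition (fun q => f @^-1` A q).
Proof.
move=> mf [mA tA cA]; split.
- by move=> i; exact: measurable_preimageT.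
- apply/trivIsetP => i j _ _ ij; rewrite -preimage_setI.
  by move/trivIsetP : tA => ->//; rewrite preimage_set0.
- by rewrite -preimage_bigcup cA preimage_setT.
Qed.

Section ConvexSimulation.
Context (G : groupType) (R : realType) d (X : measurableType d).
Context (mu : probability X R).

Lemma corr_ae d' (Y : measurableType d') (nu : {measure set Y -> \bar R})
    (s : mp_action G nu) g (A A' B B' : set Y) :
  measurable A -> measurable A' -> measurable B -> measurable B' ->
  {ae nu, forall y, A y <-> B y} -> {ae nu, forall y, A' y <-> B' y} ->
  corr s g A A' = corr s g B B'.
Proof.
move=> mA mA' mB mB' AB AB'; rewrite /corr; congr fine.
apply: ae_eq_measure.
- by apply: measurableI => //; exact: measurable_act_image.
- by apply: measurableI => //; exact: measurable_act_image.
- have AB1 := ae_act s g^-1%g AB.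
  by apply: filterS2 AB1 AB' => y h h'; rewrite !act_image /setI /=; tauto.
Qed.

(** An isomorphism pulls every partition of [X] back to one of [Y] with the
    same correlations. *)
Lemma transported_corr d' (Y : measurableType d') (nu : {measure set Y -> \bar R})
    (phi : Y -> X) (s : mp_action G nu) (c : mp_action G mu) g (A B : set X) :
  prob_iso nu mu phi -> transported phi s c -> measurable A -> measurable B ->
  corr c g A B = corr s g (phi @^-1` A) (phi @^-1` B).
Proof.
move=> [mphi phi_mu _] sc mA mB; rewrite /corr; congr fine.
have mcA := measurable_act_image c g mA.
rewrite -[LHS]phi_mu; last exact: measurableI.
apply: ae_eq_measure.
- by apply: (measurable_preimageT mphi); exact: measurableI.
- apply: measurableI; last exact: (measurable_preimageT mphi).
  by apply: measurable_act_image; exact: (measurable_preimageT mphi).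
- by apply: filterS (sc g^-1%g) => y e; rewrite !act_image /setI /= e.
Qed.

Lemma corr_sum_action (t : R) (a b : mp_action G mu) g (A B : set (bool * X)) :
  0 <= t <= 1 -> measurable A -> measurable B ->
  corr (sum_action t a b) g A B =
    t * corr a g [set x | A (true, x)] [set x | B (true, x)] +
    (1 - t) * corr b g [set x | A (false, x)] [set x | B (false, x)].
Proof.
move=> t01 mA mB.
have mI : measurable (sum_action t a b g @` A `&` B).
  by apply: measurableI => //; exact: measurable_act_image.
have msec (C : set (bool * X)) i : measurable C -> measurable [set x | C (i, x)].
  by move=> mC; apply: (@measurable_preimageT _ _ _ _ (pair i)) => //;
    exact: pair1_measurable.
have fin (m : mp_action G mu) i :
    mu (m g @` [set x | A (i, x)] `&` [set x | B (i, x)]) \is a fin_num.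
  apply: fin_num_measure; apply: measurableI; last exact: msec.
  by apply: measurable_act_image; exact: msec.
rewrite /corr two_copiesE//.
have -> : [set x | (sum_action t a b g @` A `&` B) (true, x)] =
    a g @` [set x | A (true, x)] `&` [set x | B (true, x)] by rewrite !act_image.
have -> : [set x | (sum_action t a b g @` A `&` B) (false, x)] =
    b g @` [set x | A (false, x)] `&` [set x | B (false, x)] by rewrite !act_image.
by rewrite fineD ?fin_numM// !fineM//; exact: fin.
Qed.

(** Cut a partition along the two copies, simulate each half, and glue the
    results; the glued partition of the two copies is carried back to [X] by
    the almost everywhere inverse of [phi']. *)
Lemma simulates_convex (gam : nat -> G) (t : R) n k (e f : R)
    (a b c a' b' c' : mp_action G mu) (phi phi' : bool * X -> X) :
  0 <= t <= 1 ->
  prob_iso (two_copies mu t) mu phi -> transported phi (sum_action t a b) c ->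
  prob_iso (two_copies mu t) mu phi' -> transported phi' (sum_action t a' b') c' ->
  simulates gam n k e a a' -> simulates gam n k f b b' ->
  simulates gam n k (t * e + (1 - t) * f) c c'.
Proof.
move=> t01 iso cE iso' cE' aa' bb' A pA.
have [mphi _ _] := iso.
have mpair (i : bool) : measurable_fun setT (fun x : X => (i, x)).
  exact: pair1_measurable.
have pAi i : measurable_partition (fun q => (fun x => phi (i, x)) @^-1` A q).
  by apply: measurable_partition_preimage => //; exact: (measurableT_comp mphi).
have [B1 [mB1 tB1 cB1] AB1] := aa' _ (pAi true).
have [B2 [mB2 tB2 cB2] AB2] := bb' _ (pAi false).
pose B q : set (bool * X) := [set z | if z.1 then B1 q z.2 else B2 q z.2].
have mB q : measurable (B q).
  rewrite (_ : B q = ([set true] `*` B1 q) `|` ([set false] `*` B2 q)).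
    by apply: measurableU; exact: measurableX.
  apply/seteqP; split => [[[] x] /= Bx|[[] x] /= [[]|[]]//]; [by left|by right].
have pB : measurable_partition B.
  split => //.
    apply/trivIsetP => i j _ _ ij; apply/seteqP; split => // -[[] x] [] /= Bi Bj.
      by move/trivIsetP : tB1 => /(_ i j I I ij)/seteqP[h _]; exact: (h x (conj Bi Bj)).
    by move/trivIsetP : tB2 => /(_ i j I I ij)/seteqP[h _]; exact: (h x (conj Bi Bj)).
  apply/seteqP; split => // -[[] x] _.
    by have [i _ Bi] : (\bigcup_i B1 i) x; [rewrite cB1|exists i].
  by have [i _ Bi] : (\bigcup_i B2 i) x; [rewrite cB2|exists i].
have [mphi' phi'_mu [psi [mpsi psi_nu psiphi phipsi]]] := iso'.
have [mA _ _] := pA.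
have pC := measurable_partition_preimage mpsi pB; have [mC _ _] := pC.
exists (fun q => psi @^-1` B q) => // p q r.
rewrite (transported_corr _ iso cE)// (transported_corr _ iso' cE')//.
have aeB i : {ae two_copies mu t, forall y, (phi' @^-1` (psi @^-1` B i)) y <-> B i y}.
  by apply: filterS psiphi => y /= ->.
rewrite (corr_ae _ _ _ _ _ _ (aeB q) (aeB r)) //;
  try exact: (measurable_preimageT mphi').
rewrite !corr_sum_action//; try exact: (measurable_preimageT mphi).
have := AB1 p q r; have := AB2 p q r; rewrite !ltr_norml /=.
rewrite /preimage /=.
set u := corr a _ _ _; set v := corr b _ _ _.
rewrite (_ : corr a' _ _ _ = corr a' (gam p) (B1 q) (B1 r))//.
rewrite (_ : corr b' _ _ _ = corr b' (gam p) (B2 q) (B2 r))//.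
set u' := corr a' _ _ _; set v' := corr b' _ _ _ => /andP[h1 h2] /andP[h3 h4].
have [t0|tn0] := eqVneq t 0; first by rewrite t0; apply/andP; split; lra.
have /andP[t0 t1] := t01.
have tp : 0 < t by rewrite lt_neqAle eq_sym tn0.
have t'0 : 0 <= 1 - t by rewrite subr_ge0.
have k1 : (1 - t) * - f <= (1 - t) * (v - v') by rewrite ler_wpM2l// ltW.
have k2 : (1 - t) * (v - v') <= (1 - t) * f by rewrite ler_wpM2l// ltW.
have k3 : t * - e < t * (u - u') by rewrite ltr_pM2l.
have k4 : t * (u - u') < t * e by rewrite ltr_pM2l.
by apply/andP; split; lra.
Qed.

End ConvexSimulation.

(** * Hausdorff distance of correlation sets *)

Section HausdorffDist.
Context (R : realType) (T : pseudoMetricType R).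
Implicit Types P Q : set T.

Lemma hausdorff_distC P Q : hausdorff_dist P Q = hausdorff_dist Q P.
Proof. by rewrite /hausdorff_dist maxC. Qed.

Lemma hausdorff_dist_ge0 P Q : P !=set0 -> (0 <= hausdorff_dist P Q)%E.
Proof.
move=> [p Pp]; rewrite /hausdorff_dist le_max; apply/orP; left.
by apply: le_trans (edist_inf_ge0 Q p) _; apply: ereal_sup_ubound; exists p.
Qed.

Lemma hausdorff_dist_lt_ball P Q (e : R) :
  (hausdorff_dist (closure P) (closure Q) < e%:E)%E ->
  forall p, P p -> exists2 q, Q q & ball p e q.
Proof.
rewrite /hausdorff_dist gt_max => /andP[PQ _] p Pp.
have : (edist_inf (closure Q) p < e%:E)%E.
  apply: le_lt_trans PQ; apply: ereal_sup_ubound.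
  by exists p => //; exact: subset_closure.
move=> /ereal_inf_lt[_ [y Qy <-] pye].
have fpy : edist (p, y) \is a fin_num.
  by rewrite ge0_fin_numE ?edist_ge0// (lt_trans pye)// ltry.
pose r := fine (edist (p, y)).
have rE : edist (p, y) = r%:E by rewrite fineK.
rewrite rE lte_fin in pye.
have er : 0 < (e - r) / 2 by rewrite divr_gt0// subr_gt0.
have [|q [Qq yq]] := Qy (ball y ((e - r) / 2)); first exact: nbhsx_ballx.
exists q => //; have -> : e = (r + e) / 2 + (e - r) / 2 by field.
apply: ball_triangle yq; apply: (@edist_lt_ball _ _ _ (p, y)).
by rewrite rE lte_fin; lra.
Qed.

Lemma edist_inf_closure_le P Q (e : R) : 0 < e ->
  (forall p, P p -> exists2 q, Q q & ball p e q) ->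
  (ereal_sup [set edist_inf (closure Q) x | x in closure P] <= e%:E)%E.
Proof.
move=> e0 PQ; apply: ge_ereal_sup => _ [x Px <-].
apply/lee_addgt0Pr => del del0.
have [|p [Pp xp]] := Px (ball x del); first exact: nbhsx_ballx.
have [q Qq pq] := PQ p Pp.
apply: ge_ereal_inf; exists (edist (x, q)).
  by exists q => //; exact: subset_closure.
rewrite -EFinD; apply: edist_fin; first exact: addr_gt0.
by rewrite addrC; exact: ball_triangle pq.
Qed.

Lemma hausdorff_dist_le P Q (e : R) : 0 < e ->
  (forall p, P p -> exists2 q, Q q & ball p e q) ->
  (forall q, Q q -> exists2 p, P p & ball q e p) ->
  (hausdorff_dist (closure P) (closure Q) <= e%:E)%E.
Proof. by move=> e0 PQ QP; rewrite ge_max !edist_inf_closure_le. Qed.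

End HausdorffDist.

Section CorrelationSets.
Context (G : groupType) (R : realType) d (X : measurableType d).
Context (mu : probability X R) (gam : nat -> G).
Implicit Types a b : mp_action G mu.

Definition correlation_dist n k a b : \bar R :=
  hausdorff_dist (@correlation_set _ _ _ _ _ gam n k a)
                 (@correlation_set _ _ _ _ _ gam n k b).

Lemma ball_correlations n k a b (A B : 'I_k -> set X) (e : R) : 0 < e ->
  @ball R 'rV['M[R]_k]_n (correlations gam n a A) e (correlations gam n b B) <->
  forall (p : 'I_n) q r,
    `|corr a (gam p) (A q) (A r) - corr b (gam p) (B q) (B r)| < e.
Proof.
move=> e0; split=> [[_ h] p q r|h].
  by have [_ /(_ q r)] := h ord0 p; rewrite !mxE.
split=> // i p; split=> // q r.
by have := h p q r; rewrite !mxE.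
Qed.

Lemma hausdorff_simulates n k a b (e : R) : 0 < e ->
  (correlation_dist n k a b < e%:E)%E ->
  simulates gam n k e a b.
Proof.
move=> e0 /hausdorff_dist_lt_ball ab A pA.
have [|_ [B pB <-] AB] := ab (correlations gam n a A); first by exists A.
by exists B => //; exact/(ball_correlations _ _ _ _ _ e0).
Qed.

Lemma simulates_hausdorff n k a b (e : R) : 0 < e ->
  simulates gam n k e a b -> simulates gam n k e b a ->
  (correlation_dist n k a b <= e%:E)%E.
Proof.
move=> e0 ab ba; apply: hausdorff_dist_le => //.
  move=> _ [A pA <-]; have [B pB AB] := ab A pA.
  by exists (correlations gam n b B); [exists B|exact/ball_correlations].
move=> _ [A pA <-]; have [B pB AB] := ba A pA.
by exists (correlations gam n a B); [exists B|exact/ball_correlations].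
Qed.

Lemma trivial_partition k :
  measurable_partition (fun q : 'I_k.+1 => if q == ord0 then [set: X] else set0).
Proof.
split.
- by move=> i; case: ifP.
- apply/trivIsetP => i j _ _ ij; case: eqP => [i0|_]; last by rewrite set0I.
  by case: eqP => [j0|_]; [move: ij; rewrite i0 j0 eqxx|rewrite setI0].
- by apply/seteqP; split => // x _; exists ord0.
Qed.

Lemma corr_itv a g (A B : set X) : measurable A -> measurable B ->
  0 <= corr a g A B <= 1.
Proof.
move=> mA mB; have mI : measurable (a g @` A `&` B).
  by apply: measurableI => //; exact: measurable_act_image.
by rewrite -!lee_fin /corr fineK ?fin_num_measure// measure_ge0 probability_le1.
Qed.

(** Correlations are in the unit interval, so every two differ by less than 2;
    this is what makes the Hausdorff distances finite. *)
Lemma simulates_trivial n k a b : simulates gam n k.+1 2 a b.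
Proof.
move=> A [mA _ _]; exists (fun q => if q == ord0 then setT else set0).
  exact: trivial_partition.
move=> p q r; have /andP[] := corr_itv a (gam p) (mA q) (mA r).
have [mB _ _] := trivial_partition k.
have /andP[] := corr_itv b (gam p) (mB q) (mB r).
by rewrite ltr_norml; lra.
Qed.

Lemma correlation_dist_ge0 n k a b : (0 <= correlation_dist n k.+1 a b)%E.
Proof.
apply: hausdorff_dist_ge0; exists (correlations gam n a
  (fun q => if q == ord0 then setT else set0)); apply: subset_closure.
by eexists; first exact: trivial_partition.
Qed.

Lemma correlation_dist_fin n k a b : correlation_dist n k.+1 a b \is a fin_num.
Proof.
rewrite ge0_fin_numE ?correlation_dist_ge0//.
apply: (@le_lt_trans _ _ 2%:E); last exact: ltry.
by apply: simulates_hausdorff => //; exact: simulates_trivial.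
Qed.

Lemma repr_simulates n k (x : wclass G mu) a (e : R) :
  (\pi_(wclass G mu) a = x)%qT -> 0 < e ->
  simulates gam n k.+1 e (repr x) a /\ simulates gam n k.+1 e a (repr x).
Proof.
move=> ax e0; have /eqmodP/asboolP[ra ar] : (repr x = a %[mod wclass G mu])%qT.
  by rewrite reprK ax.
by split; exact: weakly_contained_simulates.
Qed.

(** The error [4 * del] pays for the six changes of representative: the four
    inside the convex combination cost [2 * del] in total, as they are
    averaged. *)
Lemma simulates_repr_comb n k (t e f del : R) (x x' y y' z z' : wclass G mu) :
  0 <= t <= 1 -> 0 < del -> is_convex_comb t x y z -> is_convex_comb t x' y' z' ->
  simulates gam n k.+1 e (repr x) (repr x') ->
  simulates gam n k.+1 f (repr y) (repr y') ->
  simulates gam n k.+1 (t * e + (1 - t) * f + 4 * del) (repr z) (repr z').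
Proof.
move=> t01 del0 [a [b [c [phi [ax bY cz iso cE]]]]].
move=> [a' [b' [c' [phi' [ax' bY' cz' iso' cE']]]]] sx sy.
have [_ xa] := repr_simulates n k ax del0.
have [xa' _] := repr_simulates n k ax' del0.
have [_ yb] := repr_simulates n k bY del0.
have [yb' _] := repr_simulates n k bY' del0.
have [zc _] := repr_simulates n k cz del0.
have [_ zc'] := repr_simulates n k cz' del0.
have aa' := simulates_trans (simulates_trans xa sx) xa'.
have bb' := simulates_trans (simulates_trans yb sy) yb'.
have cc' := simulates_convex t01 iso cE iso' cE' aa' bb'.
have := simulates_trans (simulates_trans zc cc') zc'.
by congr (simulates _ _ _ _ _); ring.
Qed.

(** With [e] and [f] slightly above the two distances on the right,
    [simulates_repr_comb] gives simulations in both directions. *)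
Lemma hausdorff_convex n k (t : R) (x x' y y' z z' : wclass G mu) :
  let D u v := correlation_dist n k.+1 (repr u) (repr v) in
  0 <= t <= 1 -> is_convex_comb t x y z -> is_convex_comb t x' y' z' ->
  (D z z' <= t%:E * D x x' + (1 - t)%:E * D y y')%E.
Proof.
move=> D t01 zE zE'.
have Dfin u v : D u v \is a fin_num by exact: correlation_dist_fin.
have D0 u v : 0 <= fine (D u v) by apply: fine_ge0; exact: correlation_dist_ge0.
have Dsim u v (del : R) : 0 < del ->
    simulates gam n k.+1 (fine (D u v) + del) (repr u) (repr v).
  move=> del0; apply: hausdorff_simulates; first by have := D0 u v; lra.
  by rewrite -/(D u v) -[D u v]fineK// lte_fin ltrDl.
have Dsym u v : D u v = D v u by exact: hausdorff_distC.
apply/lee_addgt0Pr => e e0; pose del := e / 5; have del0 : 0 < del by exact: divr_gt0.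
have h1 := simulates_repr_comb t01 del0 zE zE' (Dsim x x' _ del0) (Dsim y y' _ del0).
have h2 := simulates_repr_comb t01 del0 zE' zE (Dsim x' x _ del0) (Dsim y' y _ del0).
rewrite -(Dsym x) -(Dsym y) in h2.
have -> : (t%:E * D x x' + (1 - t)%:E * D y y' + e%:E)%E =
    (t * (fine (D x x') + del) + (1 - t) * (fine (D y y') + del) + 4 * del)%:E.
  rewrite -[D x x' in LHS]fineK// -[D y y' in LHS]fineK//.
  by rewrite -!EFinM -!EFinD; congr EFin; rewrite /del; field.
rewrite /D; apply: simulates_hausdorff => //.
have /andP[t0 t1] := t01.
have := mulr_ge0 t0 (D0 x x'); have := D0 y y'; nra.
Qed.

End CorrelationSets.

Lemma nneseries_convex (R : realType) (u v w : nat -> \bar R) (t s : R) :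
  0 <= t -> 0 <= s ->
  (forall i, (0 <= u i.+1)%E) -> (forall i, (0 <= v i.+1)%E) ->
  (forall i, (0 <= w i.+1)%E) ->
  (forall i, (w i.+1 <= t%:E * u i.+1 + s%:E * v i.+1)%E) ->
  (\sum_(1 <= i <oo) w i <=
     t%:E * (\sum_(1 <= i <oo) u i) + s%:E * (\sum_(1 <= i <oo) v i))%E.
Proof.
move=> t0 s0 u0 v0 w0 wuv.
(* The sums start at 1, so the terms of index 0, for which nothing is known,
   are replaced by 0. *)
pose f0 (f : nat -> \bar R) i : \bar R := if i is j.+1 then f j.+1 else 0%E.
have f0E f : (\sum_(1 <= i <oo) f i = \sum_(1 <= i <oo) f0 f i)%E.
  congr (limn _); apply/funext => n; apply: eq_big_nat => i /andP[].
  by case: i.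
have f0_ge0 f : (forall i, (0 <= f i.+1)%E) -> forall i, (0 <= f0 f i)%E.
  by move=> ? [].
rewrite (f0E u) (f0E v) (f0E w) -!nneseriesZl; [|by move=> i _; exact: f0_ge0..].
rewrite -nneseriesD; [|by move=> i _ _; rewrite mule_ge0 ?f0_ge0..].
apply: lee_nneseries => [i _ _|[|i] _ /=]; first exact: f0_ge0.
  by rewrite !mule0 adde0.
exact: wuv.
Qed.

(** * Convexity of the distance *)

Section Distance.
Context (G : groupType) (R : realType) d (X : measurableType d).
Context (mu : probability X R) (gam : nat -> G).

Lemma wdistE (x y : wclass G mu) : (wdist gam x y =
  \sum_(1 <= n <oo) \sum_(1 <= k <oo)
    (2 ^- (n + k))%:E * correlation_dist gam n k (repr x) (repr y))%E.
Proof. by []. Qed.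

Lemma wdist_ge0 (x y : wclass G mu) : (0 <= wdist gam x y)%E.
Proof.
rewrite wdistE; apply: nneseries_ge0 => n _ _; apply: nneseries_ge0 => -[//|k] _ _.
by rewrite mule_ge0// ?correlation_dist_ge0// lee_fin invr_ge0 exprn_ge0.
Qed.

Lemma wdist_convex (t : R) (x x' y y' z z' : wclass G mu) :
  0 <= t <= 1 -> is_convex_comb t x y z -> is_convex_comb t x' y' z' ->
  (wdist gam z z' <= t%:E * wdist gam x x' + (1 - t)%:E * wdist gam y y')%E.
Proof.
move=> t01 zE zE'; have /andP[t0 t1] := t01.
have c0 n k : (0 <= (2 ^- (n + k) : R)%:E)%E by rewrite lee_fin invr_ge0 exprn_ge0.
have s0 n (u v : wclass G mu) k :
    (0 <= (2 ^- (n + k.+1))%:E *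
       correlation_dist gam n k.+1 (repr u) (repr v))%E.
  by rewrite mule_ge0// correlation_dist_ge0.
have t'0 : 0 <= 1 - t by rewrite subr_ge0.
have S0 n (u v : wclass G mu) : (0 <= \sum_(1 <= k <oo)
    (2 ^- (n + k))%:E * correlation_dist gam n k (repr u) (repr v))%E.
  by apply: nneseries_ge0 => -[//|k] _ _; exact: s0.
rewrite !wdistE.
apply: nneseries_convex => // i; apply: nneseries_convex => // k.
rewrite !(muleCA _ (2 ^- _)%:E) -ge0_muleDr; last 2 first.
- by rewrite mule_ge0// ?lee_fin// correlation_dist_ge0.
- by rewrite mule_ge0// ?lee_fin// correlation_dist_ge0.
by rewrite lee_wpmul2l//; exact: hausdorff_convex.
Qed.

End Distance.

(** The weights 0 and 1 are treated apart because an infimum of weight 0 may be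
    infinite. *)
Lemma ereal_inf_convex (R : realType) (A B : set (\bar R)) (t : R) (L : \bar R) :
  0 <= t <= 1 -> A !=set0 -> B !=set0 ->
  (forall a, A a -> (0 <= a)%E) -> (forall b, B b -> (0 <= b)%E) ->
  (forall a b, A a -> B b -> (L <= t%:E * a + (1 - t)%:E * b)%E) ->
  (L <= t%:E * ereal_inf A + (1 - t)%:E * ereal_inf B)%E.
Proof.
move=> t01 [a0 Aa0] [b0 Bb0] A0 B0 AB.
have infA0 : (0 <= ereal_inf A)%E by exact: le_ereal_inf_tmp.
have infB0 : (0 <= ereal_inf B)%E by exact: le_ereal_inf_tmp.
have [t0|tn0] := eqVneq t 0.
  rewrite t0 mul0e add0e subr0 mul1e; apply: le_ereal_inf_tmp => b Bb.
  by have := AB _ _ Aa0 Bb; rewrite t0 mul0e add0e subr0 mul1e.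
have [t1|tn1] := eqVneq t 1.
  rewrite t1 subrr mul0e adde0 mul1e; apply: le_ereal_inf_tmp => a Aa.
  by have := AB _ _ Aa Bb0; rewrite t1 subrr mul0e adde0 mul1e.
have tp : 0 < t by rewrite lt_neqAle eq_sym tn0; case/andP: t01.
have sp : 0 < 1 - t by rewrite subr_gt0 lt_neqAle tn1; case/andP: t01.
have [iA|iA] := eqVneq (ereal_inf A) +oo%E.
  by rewrite iA gt0_muley ?lte_fin// addye ?leey// gt_eqF//
       (lt_le_trans (ltNyr 0))// mule_ge0// lee_fin ltW.
have [iB|iB] := eqVneq (ereal_inf B) +oo%E.
  by rewrite iB gt0_muley ?lte_fin// addey ?leey// gt_eqF//
       (lt_le_trans (ltNyr 0))// mule_ge0// lee_fin ltW.
have fA : ereal_inf A \is a fin_num by rewrite ge0_fin_numE// ltey.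
have fB : ereal_inf B \is a fin_num by rewrite ge0_fin_numE// ltey.
apply/lee_addgt0Pr => e e0.
have [a Aa ae] := lb_ereal_inf_adherent e0 fA.
have [b Bb be] := lb_ereal_inf_adherent e0 fB.
apply: le_trans (AB a b Aa Bb) _.
apply: (@le_trans _ _
  (t%:E * (ereal_inf A + e%:E) + (1 - t)%:E * (ereal_inf B + e%:E))%E).
  by apply: leeD; rewrite lee_wpmul2l ?lee_fin// ltW.
rewrite -(fineK fA) -(fineK fB) -!EFinD lee_fin; lra.
Qed.

(* The enumeration [gam] makes the group countable. *)
Theorem lemma4p1 (G : groupType) (R : realType) (d : measure_display)
    (X : measurableType d) (mu : probability X R)
    (gam : nat -> G) (K : set (wclass G mu)) :
  standard_probability mu ->
  range gam = [set: G] ->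
  K !=set0 ->
  wconvex K ->
  forall (x y : wclass G mu) (t : R), 0 <= t <= 1 ->
    (wdist_set gam K (convex_comb t x y)
       <= t%:E * wdist_set gam K x + (1 - t)%:E * wdist_set gam K y)%E.
Proof.
move=> sX gamT [w Kw] cK x y t t01.
apply: ereal_inf_convex => //.
- by exists (wdist gam x w), w.
- by exists (wdist gam y w), w.
- by move=> _ [b _ <-]; exact: wdist_ge0.
- by move=> _ [b _ <-]; exact: wdist_ge0.
move=> _ _ [b Kb <-] [b' Kb' <-].
apply: ge_ereal_inf; exists (wdist gam (convex_comb t x y) (convex_comb t b b')).
  by exists (convex_comb t b b') => //; exact: cK.
by apply: wdist_convex => //; exact: (convex_combP _ _ sX gamT).
Qed.
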